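(* Consider an operational probabilistic theory (OPT) satisfying the symmetric sharpness, complete mixing, and filtering postulates. For any system $A$, there exists a Euclidean Jordan algebra $\mathbf E_A$ such that $\mathbf{St}_A$ is the cone of squares of $\mathbf E_A$. Furthermore, $\mathbf E_A$ and $\mathbf V_A$ are the same as real vector spaces.
   Context: OPT. An operational theory is a strict symmetric monoidal category: objects are systems (unit: the trivial system $I$), morphisms are processes, $\mathbf{Proc}_{A\to B}$ is the set of processes from $A$ to $B$, with sequential composition $g\circ f$, parallel composition $A\otimes B$, $f\otimes g$, identities $\mathrm{id}_A$ and swaps. States: $\mathbf{St}_A:=\mathbf{Proc}_{I\to A}\ni|\rho)$; effects: $\mathbf{Eff}_A:=\mathbf{Proc}_{A\to I}\ni(e|$; scalars: $\mathbf{Proc}_{I\to I}$; $(e|\rho):=(e|\circ|\rho)$; $af:=a\otimes f$ for a scalar $a$. A diagram $u:\mathbf{Proc}_{A\to B}\to\mathbf{Proc}_{C\to D}$ is a map $u(f)=u_2\circ(f\otimes\mathrm{id}_E)\circ u_1$ for some system $E$ and processes $u_1\in\mathbf{Proc}_{C\to A\otimes E}$, $u_2\in\mathbf{Proc}_{B\otimes E\to D}$. An OPT is an operational theory with, for all $A,B$, a collection of tests (finite families of processes from $A$ to $B$). A process $f$ is deterministic if $\{f\}$ is a test, and feasible if it belongs to some test; a measurement of $A$ is a test from $A$ to $I$. Assumptions: (1) every system has a deterministic state and a deterministic effect; sequential and parallel compositions of tests (all pairwise composites) are tests. (2) The scalars are $\mathbb R_{\ge0}$, the feasible scalars are $[0,1]$,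 composition of scalars is multiplication, $\mathrm{id}_I=1$, and every process is $af$ with $a\ge0$ and $f$ feasible. (3) The deterministic effect $(\top_A|$ of each $A$ is unique, $(\top_{A\otimes B}|=(\top_A|\otimes(\top_B|$, and a finite family $\{f_j\}$ in $\mathbf{Proc}_{A\to B}$ is a test iff $\sum_j(\top_{B\otimes E}|\circ(f_j\otimes\mathrm{id}_E)\circ|\sigma)=(\top_{A\otimes E}|\sigma)$ for all $E$ and $|\sigma)\in\mathbf{St}_{A\otimes E}$. (4) $f,f'\in\mathbf{Proc}_{A\to B}$ are equal iff $u(f)=u(f')$ for all scalar-valued diagrams $u$. (5) For feasible $g_1,g_2\in\mathbf{Proc}_{A\to B}$ and $p\in[0,1]$ there is a feasible $h$ with $u(h)=p\,u(g_1)+(1-p)u(g_2)$ for all scalar-valued diagrams $u$. Hence each $\mathbf{Proc}_{A\to B}$ is a convex cone, with sums determined by $u(f_1+f_2)=u(f_1)+u(f_2)$. (6) The real vector space $\mathbf V_{A\to B}$ spanned by $\mathbf{Proc}_{A\to B}$ (formal real combinations, identified when all scalar-valued diagrams agree) is finite-dimensional. Put $\mathbf V_A:=\mathbf V_{I\to A}$, $\mathbf V_A^*:=\mathbf V_{A\to I}$, the latter being the dual space of $\mathbf V_A$. (7) The set of normalized states $\mathbf{St}^{\mathrm N}_A:=\{|\rho)\in\mathbf{St}_A:(\top_A|\rho)=1\}$ is closed. Cones. For a cone $\mathcal C$: $x\le y$ iff $y-x\in\mathcal C$; the face of $x\in\mathcal C$ is $\mathcal F_x=\{y\in\mathcal C:\exists\delta>0,\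 \delta y\le x\}$; $x$ is an interior point if $\mathcal F_x=\mathcal C$, and atomic if $\mathcal F_x=\{px:p\ge0\}$. A state or effect is pure if atomic, completely mixed if an interior point. Distinguishability. States $|\rho_1),\dots,|\rho_k)$ of $A$ are perfectly distinguishable if there is a measurement $\{(e_i|\}_{i=1}^m$, $m\ge k$, with $(e_i|\rho_i)=(\top_A|\rho_i)$ for $i\le k$ (the measurement then perfectly distinguishes them). A PDS is a set of perfectly distinguishable normalized pure states; an MPDS is a PDS that cannot be enlarged by a further normalized pure state to a perfectly distinguishable set. A measurement with exactly $|\Phi|$ elements that perfectly distinguishes an MPDS $\Phi$ is called maximal; an effect is maximal if it belongs to some maximal measurement. Symmetric sharpness: for every normalized pure state $|\phi)$ there is exactly one maximal effect $(\phi^\dagger|$ with $(\phi^\dagger|\phi)=1$, and each maximal effect arises in this way from exactly one normalized pure state (i.e. for each maximal $(e|$ there is exactly one normalized pure $|\phi)$ with $(e|\phi)=1$); moreover $(\psi^\dagger|\varphi)=(\varphi^\dagger|\psi)$ for all normalized pure states $|\varphi),|\psi)$ of the same system. Complete mixing: every state $|\rho)$ such that $(e|\rho)\ne0$ for all maximal effects $(e|$ is completely mixed. Filtering: for every normalized pure state $|\phi)$ of any system $A$ and every $c\in[0,1]$ there is a feasible $F\in\mathbf{Proc}_{A\to A}$ with $F\circ|\phi)=c|\phi)$ and $F\circ|\rho)=|\rho)$ for every $|\rho)\in\mathbf{St}_A$ perfectly distinguishable from $|\phi)$; if $c>0$, $F$ is moreover reversible, i.e. there is $\tilde F\in\mathbf{Proc}_{A\to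 A}$ with $\tilde F\circ F\circ|\rho)=|\rho)=F\circ\tilde F\circ|\rho)$ for all $|\rho)\in\mathbf{St}_A$. A Euclidean Jordan algebra is a finite-dimensional real vector space $\mathbf E$ with a commutative bilinear product $\bullet$ satisfying $x^2\bullet(y\bullet x)=(x^2\bullet y)\bullet x$ (where $x^2=x\bullet x$) and an inner product satisfying $\langle x\bullet y,z\rangle=\langle y,x\bullet z\rangle$; its cone of squares is $\{x^2:x\in\mathbf E\}$. *)

(* Defs.v *)
From HB Require Import structures.
From mathcomp Require Import all_boot all_order all_algebra.
From mathcomp Require Import all_classical all_reals all_analysis.

Set Implicit Arguments.
Unset Strict Implicit.
Unset Printing Implicit Defensive.

Import Order.TTheory GRing.Theory Num.Theory.
Import numFieldNormedType.Exports.

Local Open Scope classical_set_scope.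
Local Open Scope ring_scope.

(* Strictness equates objects, so the strict laws on processes are stated after
   transport along these equalities. *)
Definition castproc (S : Type) (P : S -> S -> Type) (A A' B B' : S)
    (eA : A = A') (eB : B = B') (f : P A B) : P A' B' :=
  match eA in _ = X, eB in _ = Y return P X Y with
  | erefl, erefl => f
  end.

(* Strict symmetric monoidal categories. *)
Record opTheory := OpTheory {
  Sys :> Type;
  Proc : Sys -> Sys -> Type;
  idp : forall A, Proc A A;
  comp : forall A B C, Proc B C -> Proc A B -> Proc A C;
  unitS : Sys;
  tens : Sys -> Sys -> Sys;
  par : forall A B C D, Proc A B -> Proc C D -> Proc (tens A C) (tens B D);
  swap : forall A B, Proc (tens A B) (tens B A);
  comp_idl : forall A B (f : Proc A B), comp (idp B) f = f;
  comp_idr : forall A B (f : Proc A B), comp f (idp A) = f;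
  comp_assoc : forall A B C D (h : Proc C D) (g : Proc B C) (f : Proc A B),
    comp h (comp g f) = comp (comp h g) f;
  par_id : forall A B, par (idp A) (idp B) = idp (tens A B);
  par_comp : forall A B C A' B' C' (g : Proc B C) (f : Proc A B)
      (g' : Proc B' C') (f' : Proc A' B'),
    par (comp g f) (comp g' f') = comp (par g g') (par f f');
  tensA : forall A B C, tens (tens A B) C = tens A (tens B C);
  tens1l : forall A, tens unitS A = A;
  tens1r : forall A, tens A unitS = A;
  par_assoc : forall A A' B B' C C'
      (f : Proc A A') (g : Proc B B') (h : Proc C C'),
    castproc (tensA A B C) (tensA A' B' C') (par (par f g) h)
    = par f (par g h);
  par_unitl : forall A B (f : Proc A B),
    castproc (tens1l A) (tens1l B) (par (idp unitS) f) = f;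
  par_unitr : forall A B (f : Proc A B),
    castproc (tens1r A) (tens1r B) (par f (idp unitS)) = f;
  swap_nat : forall A B C D (f : Proc A B) (g : Proc C D),
    comp (swap B D) (par f g) = comp (par g f) (swap A C);
  swapK : forall A B, comp (swap B A) (swap A B) = idp (tens A B);
  swap_unit : forall A,
    castproc (tens1r A) (tens1l A) (swap A unitS) = idp A;
  swap_hexagon : forall A B C,
    comp (castproc (erefl _) (esym (tensA B C A)) (par (idp B) (swap A C)))
         (castproc (tensA A B C) (tensA B A C) (par (swap A B) (idp C)))
    = swap A (tens B C)
}.

Arguments Proc {o} A B.
Arguments idp {o} A.
Arguments comp {o A B C} g f.
Arguments unitS {o}.
Arguments tens {o} A B.
Arguments par {o A B C D} f g.
Arguments swap {o} A B.
Arguments tensA {o} A B C.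
Arguments tens1l {o} A.
Arguments tens1r {o} A.

Notation "g \c f" := (comp g f) (at level 40, left associativity).
Notation "A \ox B" := (tens A B) (at level 40, left associativity).
Notation "f \tx g" := (par f g) (at level 40, left associativity).

Section OperationalTheory.
Variable O : opTheory.
Implicit Types A B C D : O.

Definition St A := Proc unitS A.
Definition Eff A := Proc A unitS.
Definition Scal := @Proc O unitS unitS.

Definition scaleP A B (a : Scal) (f : Proc A B) : Proc A B :=
  castproc (tens1l A) (tens1l B) (a \tx f).

Record diagram A B C D := Diagram {
  anc : O;
  dg1 : Proc C (A \ox anc);
  dg2 : Proc (B \ox anc) D
}.

Definition dapp A B C D (u : diagram A B C D) (f : Proc A B) : Proc C D :=
  dg2 u \c (f \tx idp (anc u)) \c dg1 u.

Definition sdiagram A B := diagram A B unitS unitS.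

End OperationalTheory.

(* [scval] identifies the scalars with the nonnegative reals; [top A] is the
   deterministic effect of [A]; tests are families indexed by arbitrary finite
   types, so that composites are indexed by products. *)
Record optData (R : realType) := OptData {
  theory :> opTheory;
  scval : Scal theory -> R;
  test : forall (A B : theory) (J : finType), (J -> Proc A B) -> Prop;
  top : forall A : theory, Eff A
}.

Arguments scval {R} o _.
Arguments test {R} o {A B J} _.
Arguments top {R} o A.

Section ProcessSpace.
Variables (R : realType) (T : optData R).
Implicit Types A B : T.

Definition deterministic A B (f : Proc A B) : Prop :=
  test T (fun _ : unit => f).

Definition feasible A B (f : Proc A B) : Prop :=
  exists (J : finType) (t : J -> Proc A B) (j : J), test T t /\ t j = f.

Definition prob A (e : Eff A) (rho : St A) : R := scval T (e \c rho).

Definition evalfun A B (f : Proc A B) : sdiagram A B -> R^o :=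
  fun u => scval T (dapp u f).

Definition spanpred A B : {pred (sdiagram A B -> R^o)} :=
  fun v => `[< exists s : seq (R * Proc A B),
                 v = \sum_(p <- s) p.1 *: evalfun p.2 >].

Lemma spanpred_submod A B : submod_closed (@spanpred A B).
Proof.
split=> [|a u v /asboolP[s ->] /asboolP[t ->]]; apply/asboolP.
  by exists [::]; rewrite big_nil.
exists ([seq (a * p.1, p.2) | p <- s] ++ t).
rewrite big_cat big_map scaler_sumr; congr (_ + _).
by apply: eq_bigr => p _; rewrite scalerA.
Qed.

HB.instance Definition _ A B :=
  GRing.isSubmodClosed.Build R _ (@spanpred A B) (spanpred_submod A B).

(* Formal real combinations of processes, identified when all scalar-valued
   diagrams agree, are the same as linear combinations of the functionals
   [u |-> u(f)] on scalar-valued diagrams. *)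
Record procspace A B := ProcSpace {
  procfun :> sdiagram A B -> R^o;
  _ : procfun \in @spanpred A B
}.

HB.instance Definition _ A B := [isSub for @procfun A B].
HB.instance Definition _ A B := [Choice of procspace A B by <:].
HB.instance Definition _ A B := [SubChoice_isSubLmodule of procspace A B by <:].

Lemma vec_subproof A B (f : Proc A B) : evalfun f \in @spanpred A B.
Proof. by apply/asboolP; exists [:: (1, f)]; rewrite big_seq1 scale1r. Qed.

Definition vec A B (f : Proc A B) : procspace A B := ProcSpace (vec_subproof f).

Definition normalized A (rho : St A) : Prop := prob (top T A) rho = 1.

End ProcessSpace.

Record isOPT (R : realType) (T : optData R) : Prop := IsOPT {
  opt_detstate : forall A : T, exists rho : St A, deterministic rho;
  opt_deteffect : forall A : T, exists e : Eff A, deterministic e;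
  opt_testseq : forall (A B C : T) (J K : finType)
      (f : J -> Proc A B) (g : K -> Proc B C),
    test T f -> test T g -> test T (fun p : J * K => g p.2 \c f p.1);
  opt_testpar : forall (A B C D : T) (J K : finType)
      (f : J -> Proc A B) (g : K -> Proc C D),
    test T f -> test T g -> test T (fun p : J * K => f p.1 \tx g p.2);

  opt_scalinj : injective (scval T);
  opt_scalrange : range (scval T) = [set x | 0 <= x];
  opt_scalcomp : forall a b, scval T (a \c b) = scval T a * scval T b;
  opt_scalid : scval T (idp unitS) = 1;
  opt_scalfeas : forall a : Scal T, feasible a <-> 0 <= scval T a <= 1;
  opt_procscale : forall (A B : T) (f : Proc A B),
    exists (a : Scal T) (g : Proc A B), feasible g /\ f = scaleP a g;

  opt_topdet : forall A : T, deterministic (top T A);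
  opt_topuniq : forall (A : T) (e : Eff A), deterministic e -> e = top T A;
  opt_toptens : forall A B : T,
    top T (A \ox B)
    = castproc (erefl _) (tens1l unitS) (top T A \tx top T B);
  opt_testP : forall (A B : T) (J : finType) (f : J -> Proc A B),
    test T f <->
    forall (E : T) (sigma : St (A \ox E)),
      \sum_(j : J) prob (top T (B \ox E)) ((f j \tx idp E) \c sigma)
      = prob (top T (A \ox E)) sigma;

  opt_ext : forall (A B : T) (f f' : Proc A B),
    (forall u : sdiagram A B, dapp u f = dapp u f') -> f = f';

  opt_convex : forall (A B : T) (g1 g2 : Proc A B) (p : R),
    feasible g1 -> feasible g2 -> 0 <= p <= 1 ->
    exists h : Proc A B, feasible h /\
      forall u : sdiagram A B,
        scval T (dapp u h)
        = p * scval T (dapp u g1) + (1 - p) * scval T (dapp u g2);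

  opt_findim : forall A B : T,
    exists (n : nat) (h : procspace A B -> 'rV[R]_n), linear h /\ bijective h;

  (* The topology of a finite-dimensional real vector space is the one carried
     by any linear isomorphism with R^n. *)
  opt_closed : forall (A : T) (n : nat) (h : procspace unitS A -> 'rV[R]_n),
    linear h -> bijective h ->
    closed [set h (vec rho) | rho in [set rho : St A | normalized rho]]
}.

Record OPT (R : realType) := MkOPT {
  optdata :> optData R;
  optP : isOPT optdata
}.

(* The space spanned by the processes, as a finite-dimensional vector space. *)
Definition Vproc (R : realType) (T : OPT R) (A B : T) : Type := procspace A B.

HB.instance Definition _ (R : realType) (T : OPT R) (A B : T) :=
  GRing.Lmodule.copy (Vproc A B) (procspace A B).

Lemma Vproc_findim (R : realType) (T : OPT R) (A B : T) :
  exists n, inhabited (Vector.axiom n (Vproc A B)).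
Proof.
by have [n [h [hl hb]]] := opt_findim (optP T) A B; exists n; split; exists h.
Qed.

Definition Vproc_dim (R : realType) (T : OPT R) (A B : T) : nat :=
  sval (cid (Vproc_findim A B)).

Definition Vproc_iso (R : realType) (T : OPT R) (A B : T) :
    Vector.axiom (Vproc_dim A B) (Vproc A B) :=
  inhabited_witness (svalP (cid (Vproc_findim A B))).

HB.instance Definition _ (R : realType) (T : OPT R) (A B : T) :=
  Lmodule_hasFinDim.Build R (Vproc A B) (Vproc_iso A B).

Section Cones.
Variables (R : realType) (E : lmodType R).
Implicit Types (C : set E) (x y : E).

Definition cone_le C x y : Prop := C (y - x).

Definition face C x : set E :=
  [set y | C y /\ exists2 d : R, 0 < d & cone_le C (d *: y) x].

Definition interior_point C x : Prop := C x /\ face C x = C.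

Definition atomic C x : Prop :=
  C x /\ face C x = [set p *: x | p in [set p : R | 0 <= p]].

End Cones.

Section Postulates.
Variables (R : realType) (T : OPT R).
Implicit Types A B : T.

Definition VS A := Vproc (unitS : T) A.

Definition state_vec A (rho : St A) : VS A := vec rho.

Definition state_cone A : set (VS A) := range (@state_vec A).

Definition pure A (rho : St A) : Prop :=
  atomic (@state_cone A) (state_vec rho).

Definition completely_mixed A (rho : St A) : Prop :=
  interior_point (@state_cone A) (state_vec rho).

(* Normalized pure states; purity alone does not exclude the zero state. *)
Definition npure A (rho : St A) : Prop := normalized rho /\ pure rho.

Definition measurement A (J : finType) (e : J -> Eff A) : Prop := test T e.

Definition distinguishes A m k (e : 'I_m -> Eff A) (rho : 'I_k -> St A) : Prop :=
  exists km : (k <= m)%N, forall i : 'I_k,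
    prob (e (widen_ord km i)) (rho i) = prob (top T A) (rho i).

Definition perfectly_distinguishable A k (rho : 'I_k -> St A) : Prop :=
  exists m (e : 'I_m -> Eff A), measurement e /\ distinguishes e rho.

(* A set of states is perfectly distinguishable when some (hence any) injective
   enumeration of it is; [k] is then its cardinality. *)
Definition pd_set A (Phi : set (St A)) : Prop :=
  exists k (rho : 'I_k -> St A),
    [/\ injective rho, range rho = Phi & perfectly_distinguishable rho].

Definition PDS A (Phi : set (St A)) : Prop :=
  pd_set Phi /\ Phi `<=` [set phi | npure phi].

Definition MPDS A (Phi : set (St A)) : Prop :=
  PDS Phi /\
  forall phi : St A, npure phi -> ~ Phi phi -> ~ pd_set (Phi `|` [set phi]).

Definition maximal_measurement A k (e : 'I_k -> Eff A) : Prop :=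
  measurement e /\
  exists phi : 'I_k -> St A,
    [/\ injective phi, MPDS (range phi) & distinguishes e phi].

Definition maximal_effect A (e : Eff A) : Prop :=
  exists k (m : 'I_k -> Eff A), maximal_measurement m /\ range m e.

Definition is_dagger A (phi : St A) (e : Eff A) : Prop :=
  maximal_effect e /\ prob e phi = 1.

Definition symmetric_sharpness : Prop :=
  forall A : T,
  [/\ forall phi : St A, npure phi -> exists! e : Eff A, is_dagger phi e,
      forall e : Eff A, maximal_effect e ->
        exists! phi : St A, npure phi /\ prob e phi = 1 &
      forall (phi psi : St A) (e_phi e_psi : Eff A),
        npure phi -> npure psi -> is_dagger phi e_phi -> is_dagger psi e_psi ->
        prob e_psi phi = prob e_phi psi].

Definition complete_mixing : Prop :=
  forall (A : T) (rho : St A),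
    (forall e : Eff A, maximal_effect e -> prob e rho <> 0) ->
    completely_mixed rho.

Definition filtering : Prop :=
  forall (A : T) (phi : St A) (c : Scal T), npure phi -> scval T c <= 1 ->
  exists F : Proc A A,
    [/\ feasible F,
        F \c phi = scaleP c phi,
        forall rho : St A,
          perfectly_distinguishable (tnth [tuple rho; phi]) -> F \c rho = rho &
        0 < scval T c ->
        exists G : Proc A A, forall rho : St A,
          G \c (F \c rho) = rho /\ F \c (G \c rho) = rho].

End Postulates.

(* Structures of Euclidean Jordan algebra on a finite-dimensional real vector
   space; linearity in the second arguments follows by symmetry. *)
Record euclideanJordan (R : realType) (E : vectType R) := EuclideanJordan {
  jmul : E -> E -> E;
  jip : E -> E -> R;
  jmulC : forall x y, jmul x y = jmul y x;
  jmul_linear : forall a x y z, jmul (a *: x + y) z = a *: jmul x z + jmul y z;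
  jmul_jordan : forall x y,
    jmul (jmul x x) (jmul y x) = jmul (jmul (jmul x x) y) x;
  jipC : forall x y, jip x y = jip y x;
  jip_linear : forall a x y z, jip (a *: x + y) z = a * jip x z + jip y z;
  jip_pos : forall x, x != 0 -> 0 < jip x x;
  jip_assoc : forall x y z, jip (jmul x y) z = jip y (jmul x z)
}.

Definition cone_of_squares (R : realType) (E : vectType R)
    (J : euclideanJordan E) : set E := range (fun x => jmul J x x).

(* Main.v *)
Require Import Defs.
From HB Require Import structures.
From mathcomp Require Import all_boot all_order all_algebra.
From mathcomp Require Import all_classical all_reals all_analysis.
From mathcomp Require Import ring lra.

Set Implicit Arguments.
Unset Strict Implicit.
Unset Printing Implicit Defensive.

Import Order.TTheory GRing.Theory Num.Theory.
Import numFieldNormedType.Exports.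

Local Open Scope classical_set_scope.
Local Open Scope ring_scope.

(* Symmetric sharpness turns [<phi, psi> = (phi^dagger|psi)] into a symmetric
   form. Removing from a state as much as possible of the unit [u] (the sum of
   any MPDS) leaves, by complete mixing, a state annihilated by some dagger;
   iterating inside orthogonal faces with the filters [c = 0] gives a spectral
   decomposition of every vector along an MPDS. The form is therefore an inner
   product and the state cone is self-dual.
   For [c > 0] and a filter [F] of a pure state [phi], [F^* F] acts as [c ^ 2],
   [c] and [1] on the three Peirce spaces of [phi]; the middle eigenvalue is
   forced because automorphisms preserve purity, and pure states have norm equal
   to trace. So the symmetric operator [L_phi] with eigenvalues [1], [1/2], [0]
   generates automorphisms of the cone. The bracket [L_phi, L_psi] is a skew
   order derivation, hence kills [u], which says [L_phi psi = L_psi phi]. Thus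
   [L] extends linearly to a commutative product with symmetric multiplications,
   and its Jordan identity reduces, by the spectral decomposition, to
   [L_phi L_psi = L_psi L_phi] for orthogonal [phi] and [psi]. *)

(** * Spectral decomposition *)

Section Cone.
Variables (R : realType) (V : lmodType R) (C : set V).

(** [cone_arch] is closedness along rays, a substitute for topological closedness that refers to the
    order alone. *)
Record archimedean_cone : Prop := ArchimedeanCone {
  coneD : forall x y, C x -> C y -> C (x + y);
  coneZ : forall a x, 0 <= a -> C x -> C (a *: x);
  cone_pointed : forall x, C x -> C (- x) -> x = 0;
  cone_generating : forall v, exists x y, [/\ C x, C y & v = x - y];
  cone_arch : forall w z, C w -> (forall e, 0 < e -> C (z + e *: w)) -> C z
}.

Hypothesis HC : archimedean_cone.

Lemma cone0 : C 0.
Proof.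
have [x [_ [Cx _ _]]] := cone_generating HC 0.
by rewrite -(scale0r x); apply: (coneZ HC).
Qed.

Lemma cone_sum n (x : 'I_n -> V) : (forall a, C (x a)) -> C (\sum_a x a).
Proof. by move=> Cx; elim/big_ind: _ => //; [exact: cone0 | exact: coneD]. Qed.

Lemma cone_linear_ext (W : lmodType R) (F G : {linear V -> W}) :
  (forall x, C x -> F x = G x) -> F =1 G.
Proof.
move=> H v; have [x [y [Cx Cy ->]]] := cone_generating HC v.
by rewrite !linearB !H.
Qed.

(* The largest [mu] with [y - mu *: w] in the cone; it exists because an
   unbounded set of such [mu] would put [- w] in the cone. *)
Lemma cone_tight y w : C y -> C w -> w != 0 ->
  exists mu, [/\ 0 <= mu, C (y - mu *: w) &
    forall e, 0 < e -> ~ C (y - mu *: w - e *: w)].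
Proof.
move=> Cy Cw w0.
pose S := [set mu : R | 0 <= mu /\ C (y - mu *: w)].
have S0 : S 0 by split; rewrite // scale0r subr0.
have SV mu : 0 < mu -> S mu -> C (- w + mu^-1 *: y).
  move=> mu0 [_ /(coneZ HC (_ : 0 <= mu^-1))];
    rewrite invr_ge0 => /(_ (ltW mu0)).
  by rewrite scalerBr scalerA mulVf ?gt_eqF// scale1r addrC.
have Sle mu nu : 0 <= nu -> nu <= mu -> S mu -> S nu.
  move=> nu0 le [_ H]; split=> //.
  have -> : y - nu *: w = y - mu *: w + (mu - nu) *: w.
    by rewrite scalerBl addrA subrK.
  by apply: (coneD HC) => //; apply: (coneZ HC) => //; rewrite subr_ge0.
have Sub : has_ubound S.
  apply: contrapT => nub.
  have H e : 0 < e -> C (- w + e *: y).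
    move=> e0; rewrite -[e]invrK; apply: SV; rewrite ?invr_gt0//.
    apply: contrapT => nS; apply: nub; exists e^-1 => mu Smu.
    rewrite leNgt; apply/negP => lt; apply: nS.
    by apply: (Sle mu); rewrite ?invr_ge0 ?(ltW e0) ?(ltW lt).
  move/eqP: w0; apply; apply: (cone_pointed HC) => //.
  exact: (cone_arch HC Cy).
have Ssup : has_sup S by split=> //; exists 0.
have sup0 : 0 <= sup S by apply: ub_le_sup.
exists (sup S); split=> //.
  apply: (cone_arch HC Cw) => e e0.
  have [mu Smu lt] := sup_adherent e0 Ssup.
  have -> : y - sup S *: w + e *: w = y - mu *: w + (mu - (sup S - e)) *: w.
    by rewrite !scalerBl addrA subrK opprB addrA addrAC.
  apply: (coneD HC); first by case: Smu.
  by apply: (coneZ HC) => //; rewrite subr_ge0 ltW.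
move=> e e0 H.
have : S (sup S + e).
  by split; [rewrite addr_ge0// ltW | rewrite scalerDl opprD addrA].
by move/(ub_le_sup Sub); rewrite gerDl leNgt e0.
Qed.

End Cone.

(* Indices [i : I] stand for the normalized pure states [p i], with [d i] the
   functional of the maximal effect dual to [p i] and [u] the state representing
   the deterministic effect. *)
Record sharp_cone (R : realType) (V : vectType R) (C : set V) (I : Type)
    (p : I -> V) (d : I -> {scalar V}) (u : V) : Prop := SharpCone {
  sc_cone :> archimedean_cone C;
  sc_pure : forall i, C (p i);
  sc_ge0 : forall i x, C x -> 0 <= d i x;
  sc_sym : forall i j, d i (p j) = d j (p i);
  sc_diag : forall i, d i (p i) = 1;
  sc_sharp : forall i j, d i (p j) = 1 -> p i = p j;
  sc_unit : forall i, d i u = 1;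
  sc_sub : forall i, C (u - p i);
  sc_unitC : C u;
  sc_mix : forall y, C y -> (forall i, d i y != 0) ->
    forall z, C z -> exists2 e, 0 < e & C (y - e *: z);
  sc_atom : forall i y, C y -> C (p i - y) -> exists a, y = a *: p i;
  sc_filter0 : forall i, exists F : {linear V -> V},
    [/\ forall x, C x -> C (F x), F (p i) = 0 &
      forall x, C x -> d i x = 0 -> F x = x];
  sc_filter : forall i c, 0 < c < 1 -> exists F G : {linear V -> V},
    [/\ forall x, C x -> C (F x) /\ C (G x), cancel F G /\ cancel G F,
      F (p i) = c *: p i & forall x, C x -> d i x = 0 -> F x = x]
}.

Section SharpCone.
Variables (R : realType) (V : vectType R) (C : set V) (I : Type).
Variables (p : I -> V) (d : I -> {scalar V}) (u : V).
Hypothesis HC : sharp_cone C p d u.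

Let CD := coneD HC.
Let CZ := coneZ HC.

(** Complete mixing applies to [u], on which every [d i] is 1, and makes it an order unit. *)
Lemma unit_dominates x : C x -> exists2 K, 0 < K & C (K *: u - x).
Proof.
move=> Cx; have [i|e e0 H] := sc_mix HC (sc_unitC HC) _ Cx.
  by rewrite (sc_unit HC) oner_eq0.
exists e^-1; rewrite ?invr_gt0//.
have := CZ (_ : 0 <= e^-1) H; rewrite invr_ge0 (ltW e0) => /(_ isT).
by rewrite scalerBr scalerA mulVf ?gt_eqF// scale1r.
Qed.

(* The last clause provides, as a product of the zero filters of the family, a
   positive projection onto the face orthogonal to it. *)
Definition partial_frame n (f : 'I_n -> I) : Prop :=
  [/\ forall a b, d (f a) (p (f b)) = (a == b)%:R,
      C (u - \sum_a p (f a)) &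
      exists F : {linear V -> V}, [/\ forall x, C x -> C (F x),
        forall a, F (p (f a)) = 0 &
        forall x, C x -> (forall a, d (f a) x = 0) -> F x = x]].

Definition fnil (a : 'I_0) : I := False_rect I (notF (ltn_ord a)).

Definition fcons n (i : I) (f : 'I_n -> I) (a : 'I_n.+1) : I :=
  if unlift ord0 a is Some b then f b else i.

Lemma fcons0 n i (f : 'I_n -> I) : fcons i f ord0 = i.
Proof. by rewrite /fcons unlift_none. Qed.

Lemma fconsS n i (f : 'I_n -> I) a : fcons i f (lift ord0 a) = f a.
Proof. by rewrite /fcons liftK. Qed.

Lemma sum_fcons n i (f : 'I_n -> I) :
  \sum_a p (fcons i f a) = p i + \sum_a p (f a).
Proof.
rewrite big_ord_recl fcons0; congr (_ + _).
by apply: eq_bigr => a _; rewrite fconsS.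
Qed.

(** The zero filter [Z] of [i] sends [u - \sum_a p (f a)] to the same vector less [p i], which is
    therefore in the cone; composing with [Z] gives the new projection. *)
Lemma partial_frame_cons n i (f : 'I_n -> I) :
  partial_frame f -> (forall a, d i (p (f a)) = 0) -> partial_frame (fcons i f).
Proof.
move=> [orth Cu [F [FC Fp Fid]]] di.
have di' a : d (f a) (p i) = 0 by rewrite (sc_sym HC).
have [Z [ZC Zi Zid]] := sc_filter0 HC i.
split.
- move=> a b; case: (unliftP ord0 a) => [a'|] ->;
    case: (unliftP ord0 b) => [b'|] ->; rewrite ?fconsS ?fcons0 //.
  by rewrite (sc_diag HC) eqxx.
- rewrite sum_fcons opprD addrA.
  suff -> : u - p i - \sum_a p (f a) = Z (u - \sum_a p (f a)) by exact: ZC.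
  rewrite linearB (linear_sum Z) /=; congr (_ - _); last first.
    by apply: eq_bigr => a _; rewrite Zid ?di//; exact: (sc_pure HC).
  rewrite -[in RHS](subrK (p i) u) linearD Zi addr0 Zid//.
    exact: (sc_sub HC).
  by rewrite linearB/= (sc_unit HC) (sc_diag HC) subrr.
- exists (Z \o F); split=> /=.
  + by move=> x /FC/ZC.
  + move=> a; case: (unliftP ord0 a) => [a'|] ->; rewrite ?fconsS ?fcons0.
      by rewrite Fp linear0.
    by rewrite Fid//; exact: (sc_pure HC).
  + move=> x Cx H; rewrite Fid//; last by move=> a; rewrite -(fconsS i f) H.
    by rewrite Zid//; rewrite -(fcons0 i f) H.
Qed.

(** Applying [d (f a)] to a linear relation isolates one coefficient, so the [p (f a)] are
    independent. This bound stops the iteration in [spectral_aux]. *)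
Lemma partial_frame_size n (f : 'I_n -> I) :
  partial_frame f -> (n <= dim V)%N.
Proof.
move=> [orth _ _].
have : free [tuple p (f a) | a < n].
  apply/freeP => c c0 a.
  have /(congr1 (d (f a))) : \sum_b c b *: p (f b) = 0.
    rewrite -[RHS]c0; apply: eq_bigr => b _.
    by rewrite -tnth_nth tnth_mktuple.
  rewrite linear0 linear_sum (bigD1 a)//= linearZ/= orth eqxx mulr1 big1
    ?addr0//.
  by move=> b /negPf ba; rewrite linearZ/= orth eq_sym ba mulr0.
rewrite /free => /eqP; rewrite size_tuple => <-.
by rewrite (leq_trans (dimvS (subvf _)))// dimvf.
Qed.

Definition frame n (f : 'I_n -> I) : Prop :=
  (forall a b, d (f a) (p (f b)) = (a == b)%:R) /\ \sum_a p (f a) = u.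

(** The projection fixes [y] and kills [u], so it sends [K *: u - y] to [- y], and pointedness
    concludes. *)
Lemma partial_frame_unit n (f : 'I_n -> I) y : partial_frame f ->
  u - \sum_a p (f a) = 0 -> C y -> (forall a, d (f a) y = 0) -> y = 0.
Proof.
move=> [orth _ [F [FC Fp Fid]]] u0 Cy dy.
have [K K0 /FC] := unit_dominates Cy.
rewrite linearB (Fid y)// linearZ/= -(subrK (\sum_a p (f a)) u) u0 add0r.
rewrite linear_sum big1// scaler0 sub0r => CN.
exact: (cone_pointed HC).
Qed.

(* Complete mixing applied to [y - mu *: uk + \sum_a p (f a)], with [uk] the unit
   of the orthogonal face and [mu] extremal. *)
Lemma partial_frame_step n (f : 'I_n -> I) y : partial_frame f ->
  u - \sum_a p (f a) != 0 -> C y -> (forall a, d (f a) y = 0) ->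
  exists i mu, [/\ 0 <= mu, C (y - mu *: p i), d i (y - mu *: p i) = 0 &
    forall a, d i (p (f a)) = 0].
Proof.
move=> [orth Cu [F [FC Fp Fid]]] u0 Cy dy.
set w := u - _ in Cu u0.
have dw a : d (f a) w = 0.
  rewrite linearB/= (sc_unit HC) linear_sum (bigD1 a)//= orth eqxx big1 ?addr0
    ?subrr//.
  by move=> b /negPf ba; rewrite orth eq_sym ba.
have Fw : F w = w by exact: Fid.
have Fu : F u = w.
  rewrite -{1}(subrK (\sum_a p (f a)) u) linearD Fw linear_sum big1 ?addr0//.
have [mu [mu0 Cz Nz]] := cone_tight HC Cy Cu u0.
set z := y - _ in Cz Nz.
have dz a : d (f a) z = 0 by rewrite linearB linearZ/= dy dw mulr0 subrr.
have Cs : C (\sum_a p (f a)) by apply: (cone_sum HC) => a; exact: (sc_pure HC).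
(* Otherwise some [e *: u] with [e > 0] could be subtracted from this vector, and [F] would turn the
   result into [z - e *: w], against the choice of [mu]. *)
have [i] : exists i, d i (z + \sum_a p (f a)) = 0.
  apply: contrapT => H.
  have [i|e e0] := sc_mix HC (CD Cz Cs) _ (sc_unitC HC).
    by apply/eqP => di; apply: H; exists i.
  move/FC; rewrite linearB linearD linearZ/= Fu Fid// linear_sum big1 ?addr0//.
  exact: Nz.
rewrite linearD/= => /eqP; rewrite paddr_eq0 ?(sc_ge0 HC)// => /andP[/eqP diz].
rewrite linear_sum psumr_eq0/=; last by move=> a _;
  apply/(sc_ge0 HC)/(sc_pure HC).
move=> /allP dip.
have dif a : d i (p (f a)) = 0 by apply/eqP/dip; rewrite mem_index_enum.
have [_ Cw' _] := partial_frame_cons (And3 orth Cu (ex_intro _ F (And3 FC Fp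
  Fid))) dif.
rewrite sum_fcons in Cw'.
(* [y - mu *: p i] is [z + mu *: (w - p i)], and [w - p i] is what remains of [u] after the enlarged
   frame. *)
exists i, mu; rewrite -[y](subrK (mu *: w)) -/z.
have -> : z + mu *: w - mu *: p i = z + mu *: (w - p i).
  by rewrite -addrA -scalerBr.
have Ew : w - p i = u - (p i + \sum_a p (f a)) by rewrite /w opprD addrA addrAC.
rewrite Ew; split=> //.
  by apply: CD => //; apply: CZ.
rewrite linearD linearZ/= diz linearB linearD linear_sum/= (sc_unit HC)
  (sc_diag HC) big1//.
by rewrite addr0 subrr mulr0 addr0.
Qed.

(** Induction on the fuel [m], which cannot run out by [partial_frame_size]: each step removes some
    [mu *: p i] from [y] and adds [i] to [f]. *)
Lemma spectral_aux m n (f : 'I_n -> I) y : (dim V < m + n)%N ->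
  partial_frame f -> C y -> (forall a, d (f a) y = 0) ->
  exists k (g : 'I_k -> I) (c : 'I_k -> R),
    [/\ forall a b, d (g a) (p (g b)) = (a == b)%:R,
        forall a b, d (g a) (p (f b)) = 0,
        y = \sum_a c a *: p (g a) &
        u - \sum_a p (f a) = \sum_a p (g a)].
Proof.
elim: m => [|m IH] in n f y *.
  by rewrite add0n => lt /partial_frame_size; rewrite leqNgt lt.
move=> lt pf Cy dy.
have [u0|u0] := eqVneq (u - \sum_a p (f a)) 0.
  exists 0%N, fnil, (fun=> 0).
  by split; rewrite ?u0 ?big_ord0//; [case..|exact: (partial_frame_unit pf)].
have [i [mu [mu0 Cz dz dif]]] := partial_frame_step pf u0 Cy dy.
have pf' := partial_frame_cons pf dif.
have [||k [g [c [ogg ogf Ez Eu]]]] := IH _ _ (y - mu *: p i) _ pf' Cz.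
- by rewrite addnS -addSn.
- move=> a; case: (unliftP ord0 a) => [b|] ->; rewrite ?fconsS ?fcons0 //.
  by rewrite linearB linearZ/= dy (sc_sym HC) dif mulr0 subrr.
have ogi a : d (g a) (p i) = 0 by rewrite -(fcons0 i f) ogf.
have ogf' a b : d (g a) (p (f b)) = 0 by rewrite -(fconsS i f) ogf.
exists k.+1, (fcons i g), (fun a =>
  if unlift ord0 a is Some b then c b else mu).
split.
- move=> a b; case: (unliftP ord0 a) => [a'|] ->;
    case: (unliftP ord0 b) => [b'|] ->; rewrite ?fconsS ?fcons0 //.
  + by rewrite (sc_sym HC) ogi.
  + by rewrite (sc_diag HC) eqxx.
- move=> a b; case: (unliftP ord0 a) => [a'|] ->; rewrite ?fconsS ?fcons0 //.
- rewrite big_ord_recl fcons0 unlift_none -(subrK (mu *: p i) y) Ez addrC.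
  by congr (_ + _); apply: eq_bigr => a _; rewrite liftK fconsS.
- by rewrite sum_fcons -Eu sum_fcons opprD (addrCA u) addNKr.
Qed.

Lemma partial_frame_nil (f : 'I_0 -> I) : partial_frame f.
Proof.
split; first by case.
  by rewrite big_ord0 subr0; exact: (sc_unitC HC).
by exists idfun; split => // -[].
Qed.

(** With [v = x - y] and [K *: u] above [y], the vector [x + (K *: u - y)] is in the cone; since its
    frame sums to [u], removing [K *: u] lowers each coefficient by [K]. *)
Theorem spectral v : exists n (f : 'I_n -> I) (c : 'I_n -> R),
  frame f /\ v = \sum_a c a *: p (f a).
Proof.
have [x [y [Cx Cy ->]]] := cone_generating HC v.
have [K K0 CK] := unit_dominates Cy.
have [||k [g [c [ogg _ Ez Eu]]]] :=
    @spectral_aux (dim V).+1 0 fnil _ _ (partial_frame_nil fnil) (CD Cx CK).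
- by rewrite addn0.
- by case.
rewrite big_ord0 subr0 in Eu.
exists k, g, (fun a => c a - K); split; first by split.
have -> : x - y = x + (K *: u - y) - K *: u by rewrite addrA addrAC addrK.
rewrite Ez {1}Eu scaler_sumr -sumrB; apply: eq_bigr => a _.
by rewrite scalerBl.
Qed.

Lemma frame_coef n (f : 'I_n -> I) c a : frame f ->
  d (f a) (\sum_b c b *: p (f b)) = c a.
Proof.
move=> [orth _]; rewrite linear_sum (bigD1 a)//= linearZ/= orth eqxx mulr1.
by rewrite big1 ?addr0// => b /negPf ba; rewrite linearZ/= orth eq_sym ba mulr0.
Qed.

(** The coefficients of [v] in a frame are the values [d (f a) v]. *)
Lemma cone_dual v : (forall i, 0 <= d i v) -> C v.
Proof.
move=> dv; have [n [f [c [fr E]]]] := spectral v.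
rewrite E; apply: (cone_sum HC) => a; apply: CZ; last exact: (sc_pure HC).
by rewrite -(frame_coef c a fr) -E.
Qed.

End SharpCone.

(** * The inner product *)

Lemma linear_sumZ (R : pzRingType) (V W : lmodType R) (f : V -> W) (J : Type)
    (s : seq J) (c : J -> R) (x : J -> V) : linear f ->
  f (\sum_(k <- s) c k *: x k) = \sum_(k <- s) c k *: f (x k).
Proof.
move=> lf; elim: s => [|k s IH]; rewrite ?(big_nil, big_cons).
  by have := lf (-1) 0 0; rewrite !scaleN1r oppr0 addr0 addNr.
by rewrite lf IH.
Qed.

Section InnerProduct.
Variables (R : realType) (V : vectType R) (C : set V) (I : Type).
Variables (p : I -> V) (d : I -> {scalar V}) (u : V).
Hypothesis HC : sharp_cone C p d u.

Lemma pure_span v : exists s : seq (R * I), v = \sum_(k <- s) k.1 *: p k.2.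
Proof.
have [n [f [c [_ ->]]]] := spectral HC v.
exists [seq (c a, f a) | a <- enum 'I_n].
by rewrite big_map big_enum.
Qed.

Definition pure_dec v : seq (R * I) := sval (cid (pure_span v)).

Lemma pure_decE v : v = \sum_(k <- pure_dec v) k.1 *: p k.2.
Proof. exact: svalP (cid (pure_span v)). Qed.

(* A family of linear maps [T i] with [T i (p j) = T j (p i)] extends to a
   symmetric bilinear map, independently of the decompositions chosen. *)
Section Bilinear.
Variables (W : lmodType R) (T : I -> V -> W).
Hypothesis Tlin : forall i, linear (T i).
Hypothesis Tsym : forall i j, T i (p j) = T j (p i).

Definition bilinear_ext (v w : V) : W := \sum_(k <- pure_dec v) k.1 *: T k.2 w.

Lemma bilinear_ext_linearr v : linear (bilinear_ext v).
Proof.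
move=> a x y; rewrite /bilinear_ext scaler_sumr -big_split;
  apply: eq_bigr => k _ /=.
by rewrite Tlin scalerDr !scalerA mulrC.
Qed.

(** [Tsym] moves the chosen decomposition of [v] inside [T j], where it sums back to [v]. *)
Lemma bilinear_ext_pure v j : bilinear_ext v (p j) = T j v.
Proof.
rewrite [in RHS](pure_decE v) linear_sumZ//.
by apply: eq_bigr => k _; rewrite Tsym.
Qed.

Lemma bilinear_extC v w : bilinear_ext v w = bilinear_ext w v.
Proof.
rewrite {1}(pure_decE w) linear_sumZ; last exact: bilinear_ext_linearr.
by apply: eq_bigr => k _; rewrite bilinear_ext_pure.
Qed.

End Bilinear.

Definition ip : V -> V -> R := bilinear_ext (W := R^o) (fun i => d i : V -> R).

Lemma ip_linear x : linear (ip x : V -> R^o).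
Proof. by apply: bilinear_ext_linearr => i; exact: linearP. Qed.

Lemma ipC x y : ip x y = ip y x.
Proof. by apply: (bilinear_extC (W := R^o)) => [i|i j];
  [exact: linearP | exact: sc_sym HC _ _]. Qed.

Lemma ip_pr x i : ip x (p i) = d i x.
Proof. by apply: (bilinear_ext_pure (W := R^o)) => [j|j k];
  [exact: linearP | exact: sc_sym HC _ _]. Qed.

Lemma ip_pl x i : ip (p i) x = d i x.
Proof. by rewrite ipC ip_pr. Qed.

HB.instance Definition _ x :=
  GRing.isLinear.Build R V R *%R (ip x) (ip_linear x).

Lemma ipDr x y z : ip x (y + z) = ip x y + ip x z. Proof. exact: linearD. Qed.
Lemma ipNr x y : ip x (- y) = - ip x y. Proof. exact: linearN. Qed.
Lemma ipZr a x y : ip x (a *: y) = a * ip x y. Proof. exact: linearZ. Qed.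
Lemma ip0r x : ip x 0 = 0. Proof. exact: linear0. Qed.
Lemma ip_sumr x J (s : seq J) (F : J -> V) :
  ip x (\sum_(k <- s) F k) = \sum_(k <- s) ip x (F k).
Proof. exact: linear_sum. Qed.
Lemma ipDl x y z : ip (x + y) z = ip x z + ip y z.
Proof. by rewrite !(ipC _ z) ipDr. Qed.
Lemma ipNl x y : ip (- x) y = - ip x y. Proof. by rewrite !(ipC _ y) ipNr. Qed.
Lemma ipZl a x y : ip (a *: x) y = a * ip x y.
Proof. by rewrite !(ipC _ y) ipZr. Qed.
Lemma ip0l x : ip 0 x = 0. Proof. by rewrite ipC ip0r. Qed.
Lemma ip_suml x J (s : seq J) (F : J -> V) :
  ip (\sum_(k <- s) F k) x = \sum_(k <- s) ip (F k) x.
Proof. by rewrite ipC ip_sumr; apply: eq_bigr => k _; rewrite ipC. Qed.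

Definition ipE := (ipDl, ipDr, ipNl, ipNr, ipZl, ipZr, ip0l, ip0r).

Lemma ip_frame n (f : 'I_n -> I) (c e : 'I_n -> R) : frame p d u f ->
  ip (\sum_a c a *: p (f a)) (\sum_a e a *: p (f a)) = \sum_a c a * e a.
Proof.
move=> fr; rewrite ip_suml; apply: eq_bigr => a _.
by rewrite ipZl ip_pl (frame_coef _ _ fr).
Qed.

Lemma ip_gt0 x : x != 0 -> 0 < ip x x.
Proof.
have [n [f [c [fr Ex]]]] := spectral HC x.
rewrite {2 3}Ex (ip_frame _ _ fr) lt_def => x0.
rewrite sumr_ge0 ?andbT; last by move=> a _; rewrite -expr2 sqr_ge0.
rewrite psumr_eq0; last by move=> a _; rewrite -expr2 sqr_ge0.
apply: contra x0 => /allP c0; rewrite Ex big1// => a _.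
have /= := c0 a (mem_index_enum _).
by rewrite mulf_eq0 orbb => /eqP->; rewrite scale0r.
Qed.

Lemma ip_eq0 x : ip x x = 0 -> x = 0.
Proof.
by have [//|/ip_gt0 + x0] := eqVneq x 0; rewrite x0 ltxx.
Qed.

Lemma ip_inj x y : (forall z, ip x z = ip y z) -> x = y.
Proof.
move=> H; apply/subr0_eq/ip_eq0.
by rewrite ipDl ipNl H subrr.
Qed.

Lemma cone_spectral x : C x -> exists n (f : 'I_n -> I) (c : 'I_n -> R),
  [/\ frame p d u f, x = \sum_a c a *: p (f a) & forall a, 0 <= c a].
Proof.
have [n [f [c [fr Ex]]]] := spectral HC x => Cx.
exists n, f, c; split=> // a.
by rewrite -(frame_coef c a fr) -Ex (sc_ge0 HC).
Qed.

Lemma ip_ge0 x y : C x -> C y -> 0 <= ip x y.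
Proof.
move=> Cx /cone_spectral[n [f [c [_ -> c0]]]].
rewrite ip_sumr sumr_ge0// => a _.
by rewrite ipZr ip_pr mulr_ge0// (sc_ge0 HC).
Qed.

(** Together with [ip_ge0], the self-duality of the cone. *)
Lemma ip_cone y : (forall x, C x -> 0 <= ip x y) -> C y.
Proof.
move=> H; apply: (cone_dual HC) => i.
by rewrite -ip_pl H//; exact: (sc_pure HC).
Qed.

(** [gram H y] stores the numbers [ip (H e_j) y] as coordinates in a basis [e]. [gram idfun] is
    injective because the form is definite, hence invertible, and the adjoint is its inverse after
    [gram F]. *)
Lemma adjoint_ex (F : {linear V -> V}) :
  exists G : {linear V -> V}, forall x y, ip (F x) y = ip x (G y).
Proof.
pose e := vbasis (fullv : {vspace V}).
pose gram (H : {linear V -> V}) y :=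
  \sum_(j < \dim (fullv : {vspace V})) ip (H e`_j) y *: e`_j.
have gram_lin H : linear (gram H).
  move=> a x y; rewrite /gram scaler_sumr -big_split; apply: eq_bigr => j _ /=.
  by rewrite ipDr ipZr scalerDl scalerA.
pose gramL H : {linear V -> V} :=
  HB.pack (gram H) (GRing.isLinear.Build R V V *:%R (gram H) (gram_lin H)).
have ebasis : basis_of fullv e by exact: vbasisP.
have gramE H K x y : gram H x = gram K y -> forall z, ip (H z) x = ip (K z) y.
  move=> E z; have Ej (j : 'I_(\dim (fullv : {vspace V}))) : ip (H e`_j) x = ip
    (K e`_j) y.
    pose c (k : 'I_(\dim (fullv : {vspace V}))) :=
      ip (H e`_k) x - ip (K e`_k) y.
    have c0 : \sum_k c k *: e`_k = 0.
      under eq_bigr do rewrite scalerBl.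
      by rewrite sumrB -[X in X - _]/(gram H x) E subrr.
    by apply/subr0_eq; have := basis_free ebasis => /freeP/(_ c c0 j).
  rewrite (coord_vbasis (memvf z)) !linear_sum !ip_suml.
  by apply: eq_bigr => j _; rewrite !linearZ !ipZl/= Ej.
pose phi := linfun (gramL idfun).
have ker0 : lker phi == 0%VS.
  apply/lker0P => x y; rewrite !lfunE/= => /(gramE idfun idfun) H.
  by apply: ip_inj => z; rewrite !(ipC _ z) H.
exists ((phi^-1)%VF \o gramL F) => x y /=.
apply/esym/(gramE idfun F).
by rewrite -[gram idfun _](lfunE (gramL idfun)) -/phi lker0_lfunVK.
Qed.

End InnerProduct.

Arguments ip_eq0 {R V C I p d u} HC [x] _.
Arguments ip_inj {R V C I p d u} HC [x y] _.
Arguments ip_cone {R V C I p d u} HC [y] _.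

(** * Peirce decomposition and filters *)

(** Bernoulli's inequality for [c^-1 = 1 + h]. *)
Lemma expr_arbitrarily_small (R : realType) (c e : R) :
  0 < c < 1 -> 0 < e -> exists n, c ^+ n < e.
Proof.
move=> /andP[c0 c1] e0.
pose h := c^-1 - 1.
have h0 : 0 < h by rewrite subr_gt0 invf_gt1.
have ch : c * (1 + h) = 1 by rewrite /h addrC subrK mulfV ?gt_eqF.
have bern n : c ^+ n * (1 + n%:R * h) <= 1.
  elim: n => [|n IH]; first by rewrite mul0r addr0 mulr1.
  rewrite (le_trans _ IH)// exprSr -mulrA ler_wpM2l ?exprn_ge0 ?(ltW c0)//.
  have -> : c * (1 + n.+1%:R * h) = 1 + c * (n%:R * h).
    by rewrite -natr1 mulrDl mul1r addrCA mulrDr ch addrC.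
  by rewrite lerD2l ler_piMl ?(ltW c1)// mulr_ge0// ltW.
have := archi_boundP (ltW (_ : 0 < e^-1 / h)).
rewrite divr_gt0 ?invr_gt0// => /(_ isT).
set n := Num.bound _ => Hn; exists n.
have nh : 1 < e * (n%:R * h).
  by rewrite -ltr_pdivrMl// mulr1 -ltr_pdivrMr.
have nh0 : 0 <= n%:R * h by rewrite mulr_ge0// ltW.
rewrite -(ltr_pM2r (_ : 0 < 1 + n%:R * h)); last by rewrite ltr_wpDr.
by apply: le_lt_trans (bern n) _; nra.
Qed.

(** Passage to the limit in [n]: since [c ^+ n <= 1], the last two terms are at most
    [c ^+ n * (|B| + |D|)], which drops below [- A] if [A] is negative. *)
Lemma ge0_of_decay (R : realType) (c A B D : R) : 0 < c < 1 ->
  (forall n, 0 <= A + c ^+ n * B + (c ^+ n) ^+ 2 * D) -> 0 <= A.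
Proof.
move=> c01 H; rewrite leNgt; apply/negP => A0.
pose M := 1 + `|B| + `|D|.
have M0 : 0 < M by rewrite /M -addrA ltr_wpDr// addr_ge0.
have A0' : 0 < - A by rewrite oppr_gt0.
have [n Hn] := expr_arbitrarily_small c01 (divr_gt0 A0' M0).
have := H n; move: Hn; rewrite ltr_pdivlMr//.
have [c0 c1] := andP c01.
have := exprn_ge0 n (ltW c0); have := exprn_ile1 n (ltW c0) (ltW c1).
move: (c ^+ n) => e e1 e0.
have := ler_norm B; have := ler_norm D; rewrite /M.
move: `|B| `|D| (normr_ge0 B) (normr_ge0 D) => b f b0 f0 Df Bb H1 H2.
have h1 : e * B <= e * b by rewrite ler_wpM2l.
have h2 : e ^+ 2 * D <= e ^+ 2 * f by rewrite ler_wpM2l ?sqr_ge0.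
have h3 : e ^+ 2 * f <= e * f by rewrite ler_wpM2r// expr2 ler_piMl.
lra.
Qed.

Section Peirce.
Variables (R : realType) (V : vectType R) (C : set V) (I : Type).
Variables (p : I -> V) (d : I -> {scalar V}) (u : V).
Hypothesis HC : sharp_cone C p d u.

Let CD := coneD HC.
Let CZ := coneZ HC.
Let Cp := sc_pure HC.
Notation ip := (ip HC).
Notation ip_pl := (ip_pl HC).
Notation ip_pr := (ip_pr HC).

Lemma ip_ur i : ip u (p i) = 1.
Proof. by rewrite ip_pr (sc_unit HC). Qed.

Lemma d_sub i : d i (u - p i) = 0.
Proof. by rewrite linearB/= (sc_unit HC) (sc_diag HC) subrr. Qed.

(** Every term of the spectral decomposition of [y] is orthogonal to [u - p i]: its coefficient
    vanishes, or [d (f a) (p i) = 1] and sharpness gives [p (f a) = p i]. *)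
Lemma face_unit_inj i y : C y -> ip y (u - p i) = 0 -> y = d i y *: p i.
Proof.
move=> Cy; have [n [f [c [fr Ey c0]]]] := cone_spectral HC Cy.
rewrite Ey ip_suml => y0.
have H a : c a *: p (f a) = c a *: p i.
  have nn b : true -> 0 <= ip (c b *: p (f b)) (u - p i).
    by rewrite ipZl ip_pl mulr_ge0// (sc_ge0 HC)//; exact: (sc_sub HC).
  have := psumr_eq0P nn y0 (isT : xpredT a).
  rewrite ipZl ip_pl linearB/= (sc_unit HC) => /eqP.
  rewrite mulf_eq0 subr_eq0 => /orP[].
  - by move/eqP->; rewrite !scale0r.
  - by move/eqP/esym/(sc_sharp HC)->.
under eq_bigr do rewrite H.
rewrite linear_sum scaler_suml/=; apply: eq_bigr => a _.
by rewrite linearZ/= (sc_diag HC) mulr1.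
Qed.

Definition zfilter i : {linear V -> V} := sval (cid (sc_filter0 HC i)).

Lemma zfilterC i x : C x -> C (zfilter i x).
Proof. by rewrite /zfilter; case: cid => Z /= [H _ _]; exact: H. Qed.

Lemma zfilterp i : zfilter i (p i) = 0.
Proof. by rewrite /zfilter; case: cid => Z /= [_ H _]. Qed.

Lemma zfilter_id i x : C x -> d i x = 0 -> zfilter i x = x.
Proof. by rewrite /zfilter; case: cid => Z /= [_ _ H]; exact: H. Qed.

Lemma zfilteru i : zfilter i u = u - p i.
Proof.
rewrite -[in LHS](subrK (p i) u) linearD zfilterp addr0 zfilter_id ?d_sub//.
exact: (sc_sub HC).
Qed.

(** For [y] in the cone below [K *: u], positivity squeezes the value between 0 and that at
    [K *: (u - p i)], which is 0. *)
Lemma zfilter_face i x : d i (zfilter i x) = 0.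
Proof.
have H y : C y -> d i (zfilter i y) = 0.
  move=> Cy; have [K K0 CK] := unit_dominates HC Cy.
  apply/eqP; rewrite eq_le (sc_ge0 HC) ?andbT; last exact: zfilterC.
  have := sc_ge0 HC i (zfilterC i CK).
  by rewrite linearB linearZ zfilteru linearB linearZ/= d_sub mulr0 sub0r
    oppr_ge0.
have [y [z [Cy Cz ->]]] := cone_generating HC x.
by rewrite !linearB/= !H// subrr.
Qed.

Lemma zfilterK i x : zfilter i (zfilter i x) = zfilter i x.
Proof.
apply: (cone_linear_ext HC (F := zfilter i \o zfilter i)) => y Cy /=.
by apply: zfilter_id; [exact: zfilterC | exact: zfilter_face].
Qed.

(** [T' y] lies in the face [d i = 0], so [T] fixes both [y] and [T' y], and the squared norm of
    [T' y - y] expands to 0. *)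
Lemma adjoint_face i s (T T' : {linear V -> V}) :
  (forall x, C x -> C (T x)) -> (forall x y, ip (T x) y = ip x (T' y)) ->
  T (p i) = s *: p i -> (forall x, C x -> d i x = 0 -> T x = x) ->
  forall y, C y -> d i y = 0 -> T' y = y.
Proof.
move=> TC adj Tp Tid y Cy dy.
have CTy : C (T' y) by apply: (ip_cone HC) => z Cz; rewrite -adj ip_ge0//;
  exact: TC.
have dT : d i (T' y) = 0 by rewrite -ip_pl -adj Tp ipZl ip_pl dy mulr0.
have H x : C x -> d i x = 0 -> ip x (T' y) = ip x y by move=> *;
  rewrite -adj Tid.
by apply/subr0_eq/(ip_eq0 HC); rewrite !ipE !H//; ring.
Qed.

Lemma linear_face_ext i (T : {linear V -> V}) :
  (forall x, C x -> d i x = 0 -> T x = x) ->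
  forall x, T (zfilter i x) = zfilter i x.
Proof.
move=> Tid; apply: (cone_linear_ext HC (F := T \o zfilter i)) => x Cx /=.
by apply: Tid; [exact: zfilterC | exact: zfilter_face].
Qed.

(** The adjoint of [zfilter i] also fixes the face, so [ip (zfilter i z) (zfilter i z')] equals
    [ip z (zfilter i z')], and the former is symmetric. *)
Lemma ip_zfilter i x y : ip (zfilter i x) y = ip x (zfilter i y).
Proof.
have [Z adj] := adjoint_ex HC (zfilter i).
have Zid : forall y', C y' -> d i y' = 0 -> Z y' = y'.
  apply: (@adjoint_face _ 0 (zfilter i)) => //; first exact: zfilterC.
    by rewrite scale0r zfilterp.
  exact: zfilter_id.
have H z z' : ip (zfilter i z) (zfilter i z') = ip z (zfilter i z').
  by rewrite adj linear_face_ext.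
by rewrite -[RHS]H ipC -[LHS]H ipC.
Qed.

(** What filters, their adjoints and their products share; only the action on the middle Peirce
    space stays open. *)
Record peirce_aut i (s : R) (T T' : {linear V -> V}) : Prop := PeirceAut {
  paC : forall x, C x -> C (T x);
  pa_inv : exists G : {linear V -> V},
    [/\ cancel T G, cancel G T & forall x, C x -> C (G x)];
  pa_adj : forall x y, ip (T x) y = ip x (T' y);
  pa_p : T (p i) = s *: p i;
  pa_p' : T' (p i) = s *: p i;
  pa_Z : forall x, T (zfilter i x) = zfilter i x;
  pa_Z' : forall x, T' (zfilter i x) = zfilter i x
}.

Lemma peirce_aut_id i : peirce_aut i 1 idfun idfun.
Proof.
by split=> //=; rewrite ?scale1r//; exists idfun; split.
Qed.

Lemma peirce_aut_comp i s1 s2 T1 T1' T2 T2' :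
  peirce_aut i s1 T1 T1' -> peirce_aut i s2 T2 T2' ->
  peirce_aut i (s1 * s2) (T1 \o T2) (T2' \o T1').
Proof.
move=> [C1 [G1 [K1 K1' CG1]] A1 P1 P1' Z1 Z1'].
move=> [C2 [G2 [K2 K2' CG2]] A2 P2 P2' Z2 Z2'].
split=> /=.
- by move=> x /C2/C1.
- exists (G2 \o G1); split; [exact: can_comp|exact: can_comp|].
  by move=> x /CG1/CG2.
- by move=> x y; rewrite A1 A2.
- by rewrite P2 linearZ/= P1 scalerA mulrC.
- by rewrite P1' linearZ/= P2' scalerA.
- by move=> x; rewrite Z2 Z1.
- by move=> x; rewrite Z1' Z2'.
Qed.

(** Self-duality makes adjoints positive, and the adjoint of the inverse inverts the adjoint. *)
Lemma peirce_aut_adj i s T T' : peirce_aut i s T T' -> peirce_aut i s T' T.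
Proof.
move=> [C1 [G1 [K1 K1' CG1]] A1 P1 P1' Z1 Z1'].
have adj x y : ip (T' x) y = ip x (T y) by rewrite ipC -A1 ipC.
have [G' adjG] := adjoint_ex HC G1.
split=> //.
- by move=> x Cx; apply: (ip_cone HC) => y Cy; rewrite -A1 ip_ge0//; exact: C1.
- exists G'; split.
  + move=> x; apply: (ip_inj HC) => z.
    by rewrite ipC -adjG -A1 K1' ipC.
  + move=> x; apply: (ip_inj HC) => z.
    by rewrite ipC -A1 -adjG K1 ipC.
  + move=> x Cx; apply: (ip_cone HC) => y Cy.
    by rewrite -adjG ip_ge0//; exact: CG1.
Qed.

(** [F] fixes [u - p i], so [F' (p i)] is orthogonal to it, hence a multiple of [p i]. *)
Lemma peirce_filter i c : 0 < c < 1 -> exists F F', peirce_aut i c F F'.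
Proof.
move=> c01; have [F [G [CFG [FK GK] Fp Fid]]] := sc_filter HC i c01.
have [F' adj] := adjoint_ex HC F.
have CF x : C x -> C (F x) by case/CFG.
exists F, F'; split=> //.
- by exists G; split=> // x /CFG[].
- have CF' : C (F' (p i)) by apply: (ip_cone HC) => y Cy;
  rewrite -adj ip_ge0//; exact: CF.
  rewrite (face_unit_inj CF' (i := i)); last first.
    by rewrite ipC -adj Fid ?d_sub// ?ip_pr ?d_sub//; exact: (sc_sub HC).
  by rewrite -ip_pl -adj Fp ipZl ip_pl (sc_diag HC) mulr1.
- exact: linear_face_ext.
- by apply: linear_face_ext; apply: (adjoint_face CF adj Fp).
Qed.

(* An automorphism maps a pure state to a multiple of a pure state, and those
   are the elements of the cone whose norm equals their trace. *)
Lemma aut_pure_norm (T G : {linear V -> V}) j :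
  cancel T G -> cancel G T ->
  (forall x, C x -> C (T x)) -> (forall x, C x -> C (G x)) ->
  ip (T (p j)) (T (p j)) = ip u (T (p j)) ^+ 2.
Proof.
move=> TK GK CT CG.
have [n [f [c [fr Ex c0]]]] := cone_spectral HC (CT _ (Cp j)).
have [orth _] := fr.
(* Each term lies below [T (p j)]; [G] carries it below [p j], where atomicity applies. Orthogonal
   terms that are all multiples of one vector cannot include two nonzero ones. *)
have prop a : exists e, c a *: p (f a) = e *: T (p j).
  have [||e He] := sc_atom HC (i := j) (y := G (c a *: p (f a))).
  - by apply: CG; apply: CZ.
  - rewrite -{1}(TK (p j)) -linearB; apply: CG.
    rewrite Ex (bigD1 a)//= addrAC subrr add0r.
    by elim/big_ind: _ => // [|b _]; [exact: (cone0 HC) | exact: CZ].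
  - by exists e; rewrite -linearZ -He GK.
have cc a b : a != b -> c a * c b = 0.
  move=> /negPf ab; have [e He] := prop a.
  have := congr1 (d (f a)) He; have := congr1 (d (f b)) He.
  rewrite !linearZ/= !orth eqxx mulr1 eq_sym ab mulr0 Ex !(frame_coef c _ fr).
  by move=> E0 E1; rewrite E1 -mulrA mulrCA -E0 mulr0.
rewrite Ex (ip_frame HC _ _ fr) ip_sumr.
under [in RHS]eq_bigr do rewrite ipZr ip_ur mulr1.
rewrite expr2 mulr_suml; apply: eq_bigr => a _.
rewrite (bigD1 a)//= mulrDr mulr_sumr big1 ?addr0// => b ba.
by rewrite cc// eq_sym.
Qed.

(* Locked, lest [linearD] see through it. *)
Definition phalf : I -> V -> V :=
  locked (fun i x => x - d i x *: p i - zfilter i x).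

Lemma phalf_def i x : phalf i x = x - d i x *: p i - zfilter i x.
Proof. by rewrite /phalf -lock. Qed.

Lemma phalf_linear i : linear (phalf i).
Proof.
move=> a x y; rewrite !phalf_def !linearP.
by apply: (ip_inj HC) => z; rewrite !ipE/=; ring.
Qed.

HB.instance Definition _ i :=
  GRing.isLinear.Build R V V *:%R (phalf i) (phalf_linear i).

Lemma phalfE i x : x = d i x *: p i + phalf i x + zfilter i x.
Proof. by rewrite phalf_def -addrA subrK addrC subrK. Qed.

Lemma d_phalf i x : d i (phalf i x) = 0.
Proof.
by rewrite phalf_def !linearB linearZ/= zfilter_face (sc_diag HC) mulr1 subr0
  subrr.
Qed.

Lemma zfilter_phalf i x : zfilter i (phalf i x) = 0.
Proof. by rewrite phalf_def !linearB linearZ/= zfilterp zfilterK scaler0 subr0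
  subrr. Qed.

Lemma ip_zfilter_phalf i x y : ip (zfilter i x) (phalf i y) = 0.
Proof. by rewrite ip_zfilter zfilter_phalf ip0r. Qed.

(** Expansion of [aut_pure_norm]: the three Peirce components of [T (p j)] stay orthogonal. The map
    enters the right-hand side only through [s], and affinely. *)
Lemma peirce_norm i j s T T' : peirce_aut i s T T' ->
  ip (T (phalf i (p j))) (T (phalf i (p j))) =
  (1 - d i (p j)) ^+ 2 - ip (zfilter i (p j)) (zfilter i (p j)) +
  2 * d i (p j) * (1 - d i (p j)) * s.
Proof.
move=> [C1 [G1 [K1 K1' CG1]] A1 P1 P1' Z1 Z1'].
have := aut_pure_norm j K1 K1' C1 CG1.
set w := phalf i (p j); set z := zfilter i (p j); set a := d i (p j).
have pw : ip (p i) (T w) = 0 by rewrite ipC A1 P1' ipZr ip_pr d_phalf mulr0.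
have zw x : ip (zfilter i x) (T w) = 0.
  by rewrite ipC A1 Z1' ipC ip_zfilter_phalf.
have pz x : ip (p i) (zfilter i x) = 0 by rewrite ip_pl zfilter_face.
have pp : ip (p i) (p i) = 1 by rewrite ip_pl (sc_diag HC).
have -> : T (p j) = (s * a) *: p i + T w + z.
  by rewrite [in LHS](phalfE i (p j)) !linearD linearZ /= P1 Z1 scalerA mulrC.
have uw : ip u (T w) = 0.
  have -> : ip u (T w) = ip (zfilter i u) (T w) + ip (p i) (T w).
    by rewrite -ipDl zfilteru subrK.
  by rewrite zw pw addr0.
have uz : ip u z = 1 - a.
  by rewrite -ip_zfilter zfilteru ipDl ipNl ip_ur ip_pl.
rewrite !ipE (ipC _ (T w) (p i)) (ipC _ (T w) z) (ipC _ z (p i)).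
rewrite pw zw pz pp uw uz ip_ur => H.
apply/eqP; rewrite -subr_eq0; apply/eqP.
move/eqP: H; rewrite -subr_eq0 => /eqP <-; ring.
Qed.

End Peirce.

(** * The Jordan product *)

Section Jordan.
Variables (R : realType) (V : vectType R) (C : set V) (I : Type).
Variables (p : I -> V) (d : I -> {scalar V}) (u : V).
Hypothesis HC : sharp_cone C p d u.

Let CD := coneD HC.
Let CZ := coneZ HC.
Let Cp := sc_pure HC.
Notation ip := (ip HC).
Notation zfilter := (zfilter HC).
Notation phalf := (phalf HC).
Notation peirce_aut := (peirce_aut HC).

Lemma pure_linear_ext (W : lmodType R) (F G : {linear V -> W}) :
  (forall i, F (p i) = G (p i)) -> F =1 G.
Proof.
move=> H x; rewrite (pure_decE HC x) !linear_sum.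
by apply: eq_bigr => k _; rewrite !linearZ/= H.
Qed.

(* [S = F^* F] for a filter [F]. The moments [<S^n w, w>] are affine in [c ^ n],
   so [(S - 1) (S - c) w = 0]; the component of [w] fixed by [S] survives in the
   limit of [S^n (p j)], which lies in the face orthogonal to [p i], hence it
   vanishes. *)
Lemma peirce_root i c : 0 < c < 1 -> exists S, peirce_aut i (c * c) S S /\
  forall x, S (phalf i x) = c *: phalf i x.
Proof.
move=> c01; have [F [F' pF]] := peirce_filter HC i c01.
pose S : {linear V -> V} := F' \o F.
have pS : peirce_aut i (c * c) S S.
  exact: peirce_aut_comp (peirce_aut_adj pF) pF.
have pFS := peirce_aut_comp pF pS.
have pSS := peirce_aut_comp pS pS.
exists S; split=> //.
suff H j : S (phalf i (p j)) = c *: phalf i (p j).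
  by apply: (@pure_linear_ext _ (S \o phalf i) (c \*: phalf i)) => j; exact: H.
(* The identity, [F], [S], [F \o S] and [S \o S] scale [p i] by [c ^ n] for [n] from 0 to 4 and
   yield the moments [ip (S^n w) w]. *)
have := peirce_norm j (peirce_aut_id HC i).
have := peirce_norm j pF; have := peirce_norm j pS.
have := peirce_norm j pFS; have := peirce_norm j pSS.
have aF := pa_adj pF; have aS := pa_adj pS.
set w := phalf i (p j); set a := d i (p j); set z := zfilter i (p j).
have SE x : F' (F x) = S x by [].
rewrite /= !aF !SE => m4 m3 m2 m1 m0.
have Ew : p j = a *: p i + w + z by exact: phalfE.
have dw : d i w = 0 by exact: d_phalf.
have Zw : zfilter i w = 0 by exact: zfilter_phalf.
have dz : d i z = 0 by exact: zfilter_face.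
have Zz : zfilter i z = z by exact: zfilterK.
have Sz : S z = z by exact: (pa_Z pS).
clear SE pFS pSS; clearbody w z S; have [c0 c1] := andP c01.
(* The squared norm of the difference combines the moments with the coefficients of
   [((t - 1) (t - c))^2], which annihilate both the constant sequence and [c ^ n]. *)
have v0 : S (S w) = (1 + c) *: S w - c *: w.
  apply/subr0_eq/(ip_eq0 HC); rewrite !ipE.
  rewrite (ipC HC (S (S w)) (S w)).
  rewrite (ipC HC (S w) w) (ipC HC (S (S w)) w).
  rewrite -(aS w (S w)) m4 m3 m2 m1 m0; ring.
have c1' : 1 - c != 0 by rewrite subr_eq0 eq_sym lt_eqF.
(* The components of [w] for the eigenvalues 1 and [c] of [S]. *)
pose w1 := (1 - c)^-1 *: (S w - c *: w).
pose w2 := (1 - c)^-1 *: (w - S w).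
have Sw1 : S w1 = w1.
  rewrite linearZ linearB linearZ/= v0; congr (_ *: _).
  by apply: (ip_inj HC) => y; rewrite !ipE; ring.
have Sw2 : S w2 = c *: w2.
  rewrite linearZ linearB/= v0.
  by apply: (ip_inj HC) => y; rewrite !ipE; ring.
have w12 : w = w1 + w2.
  by apply: (ip_inj HC) => y; rewrite !ipE; field.
have dw1 : d i w1 = 0.
  rewrite linearZ linearB linearZ /= -(ip_pl HC) -aS (pa_p pS) ipZl.
  by rewrite ip_pl dw !mulr0 subrr mulr0.
have Zw1 : zfilter i w1 = 0.
  apply: (ip_inj HC) => y'; rewrite ip0l ip_zfilter -Sw1 aS (pa_Z pS).
  rewrite ipZl ipDl ipNl ipZl aS (pa_Z pS) -!ip_zfilter Zw ip0l.
  by rewrite mulr0 subrr mulr0.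
have w10 : w1 = 0 -> S w = c *: w.
  move=> /eqP; rewrite scaler_eq0 invr_eq0 (negPf c1')/= => /eqP.
  by move/subr0_eq.
clearbody w1 w2.
pose y n := (c ^+ n) ^+ 2 *: (a *: p i) + w1 + c ^+ n *: w2 + z.
have Cy n : C (y n).
  elim: n => [|n IH].
    rewrite /y !expr0 expr1n !scale1r -(addrA (a *: p i)) -w12 -Ew.
    exact: Cp.
  suff -> : y n.+1 = S (y n) by exact: (paC pS).
  rewrite /y !linearD !linearZ /= Sw1 Sw2 (pa_p pS) Sz.
  by apply: (ip_inj HC) => y'; rewrite !ipE !exprS; ring.
have Cwz : C (w1 + z).
  apply: (cone_dual HC) => k.
  apply: (@ge0_of_decay _ c _ (d k w2) (a * d k (p i))) => // n.
  have := sc_ge0 HC k (Cy n); rewrite !linearD !linearZ /=.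
  by congr (_ <= _); ring.
(* The limit [w1 + z] is in the face, so [zfilter i] fixes it, yet maps it to [z]. *)
have := zfilter_id HC (i := i) Cwz; rewrite !linearD/= dw1 Zw1 dz Zz.
rewrite addr0 add0r => /(_ erefl) zE.
by apply: w10; apply: (addIr z); rewrite add0r -zE.
Qed.

Lemma phalfD i x y : phalf i (x + y) = phalf i x + phalf i y.
Proof. exact: linearD. Qed.

Lemma phalfZ i a x : phalf i (a *: x) = a *: phalf i x.
Proof. exact: linearZ. Qed.

Lemma phalf_p i : phalf i (p i) = 0.
Proof. by rewrite !phalf_def (sc_diag HC) scale1r subrr zfilterp subr0. Qed.

Lemma phalf_zfilter i x : phalf i (zfilter i x) = 0.
Proof. by rewrite !phalf_def zfilter_face scale0r subr0 zfilterK subrr. Qed.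

Lemma phalfK i x : phalf i (phalf i x) = phalf i x.
Proof. by rewrite phalf_def d_phalf scale0r subr0 zfilter_phalf subr0. Qed.

Lemma ip_phalf i x y : ip (phalf i x) y = ip x (phalf i y).
Proof. by rewrite !phalf_def !ipE ip_zfilter ip_pr ip_pl; ring. Qed.

Lemma phalf_orth i j : d i (p j) = 0 -> phalf i (p j) = 0.
Proof.
by move=> dij; rewrite !phalf_def dij scale0r subr0 zfilter_id ?subrr.
Qed.

(** In Jordan terms, the quadratic representation of [t *: p i + (u - p i)]. Its derivative at
    [t = 1] is twice [jmul_pure i]. *)
Definition peirceU i t x : V :=
  (t ^+ 2 * d i x) *: p i + t *: phalf i x + zfilter i x.

Lemma peirceU_linear i t : linear (peirceU i t).
Proof.
move=> a x y; rewrite /peirceU !linearP.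
by apply: (ip_inj HC) => z; rewrite !ipE/=; ring.
Qed.

HB.instance Definition _ i t :=
  GRing.isLinear.Build R V V *:%R (peirceU i t) (peirceU_linear i t).

Lemma peirceU1 i x : peirceU i 1 x = x.
Proof. by rewrite /peirceU expr1n mul1r scale1r -phalfE. Qed.

Lemma peirceU_comp i s t x : peirceU i t (peirceU i s x) = peirceU i (t * s) x.
Proof.
have := (phalfK i x, phalf_zfilter i x, zfilter_phalf HC i x, zfilterK HC i x,
  zfilter_face HC i x, d_phalf HC i x).
rewrite /peirceU; move: (phalf i x) (zfilter i x) => y z E.
rewrite !phalfD !phalfZ !(linearD (d i)) !(linearD (zfilter i)).
rewrite !(linearZ_LR (d i)) !(linearZ_LR (zfilter i)) /= phalf_p zfilterp
  (sc_diag HC) !E.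
by apply: (ip_inj HC) => z'; rewrite !ipE; ring.
Qed.

(** For [t < 1] this is the map of [peirce_root]; for [t > 1], the inverse of the one for [t^-1]. *)
Lemma peirceU_cone i t x : 0 < t -> C x -> C (peirceU i t x).
Proof.
have key c y S : 0 < c < 1 -> peirce_aut i (c * c) S S ->
    (forall x, S (phalf i x) = c *: phalf i x) -> S y = peirceU i c y.
  move=> c01 pS Sh; rewrite [in LHS](phalfE HC i y) !linearD linearZ/=.
  by rewrite (pa_p pS) (pa_Z pS) Sh scalerA mulrC -expr2.
move=> t0 Cx; have [t1|t1|->] := ltrgtP t 1; last by rewrite peirceU1.
  have t01 : 0 < t < 1 by rewrite t0.
  have [S [pS Sh]] := peirce_root i t01.
  by rewrite -(key t x S)//; exact: (paC pS).
have t01 : 0 < t^-1 < 1 by rewrite invr_gt0 t0 invf_lt1.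
have [S [pS Sh]] := peirce_root i t01.
have [G [SK GK CG]] := pa_inv pS.
rewrite -(GK x) (key _ _ _ t01 pS Sh) peirceU_comp mulfV ?gt_eqF// peirceU1.
exact: CG.
Qed.

Lemma ip_peirceU i t x y : ip (peirceU i t x) y = ip x (peirceU i t y).
Proof. by rewrite /peirceU !ipE ip_zfilter ip_phalf ip_pr ip_pl; ring. Qed.

Definition jmul_pure i x : V := d i x *: p i + 2^-1 *: phalf i x.

Lemma jmul_pure_linear i : linear (jmul_pure i).
Proof.
move=> a x y; rewrite /jmul_pure !linearP.
by apply: (ip_inj HC) => z; rewrite !ipE/=; ring.
Qed.

HB.instance Definition _ i :=
  GRing.isLinear.Build R V V *:%R (jmul_pure i) (jmul_pure_linear i).

Lemma ip_jmul_pure i x y : ip (jmul_pure i x) y = ip x (jmul_pure i y).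
Proof. by rewrite /jmul_pure !ipE ip_phalf ip_pr ip_pl; ring. Qed.

Lemma jmul_pureE i x : jmul_pure i x = 2^-1 *: (x + d i x *: p i - zfilter i x).
Proof.
by apply: (ip_inj HC) => z; rewrite /jmul_pure phalf_def !ipE; field.
Qed.

Lemma jmul_pure_u i : jmul_pure i u = p i.
Proof.
rewrite jmul_pureE zfilteru (sc_unit HC) scale1r.
by apply: (ip_inj HC) => z; rewrite !ipE; field.
Qed.

Lemma jmul_pure_id i : jmul_pure i (p i) = p i.
Proof. by rewrite /jmul_pure phalf_p scaler0 addr0 (sc_diag HC) scale1r. Qed.

Lemma jmul_pure_orth i j : d i (p j) = 0 -> jmul_pure i (p j) = 0.
Proof.
by move=> dij; rewrite /jmul_pure phalf_orth// dij scale0r scaler0 addr0.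
Qed.

(* The infinitesimal version of [X] generating automorphisms of the cone. *)
Definition order_derivation (X : V -> V) : Prop :=
  forall x y, C x -> C y -> ip x y = 0 -> ip (X x) y = 0.

(** [s ^+ 2 * A + s * B + D], the pairing of [peirceU i s x] with [y], is nonnegative for [s > 0]
    and 0 at [s = 1]. Its derivative [2 * A + B] there, twice the value sought, therefore
    vanishes. *)
Lemma jmul_pure_derivation i : order_derivation (jmul_pure i).
Proof.
move=> x y Cx Cy xy0.
set A := d i x * d i y; set B := ip (phalf i x) y; set D := ip (zfilter i x) y.
have H s : 0 < s -> 0 <= s ^+ 2 * A + s * B + D.
  move=> s0; have := ip_ge0 HC (peirceU_cone i s0 Cx) Cy.
  by rewrite /peirceU !ipE ip_pl -mulrA.
have ABD : A + B + D = 0.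
  by rewrite -xy0 [x in RHS](phalfE HC i) !ipE ip_pl.
have h01 (n : nat) : 0 < (2^-1 : R) ^+ n by rewrite exprn_gt0// invr_gt0.
have h1 (n : nat) : (2^-1 : R) ^+ n <= 1 by rewrite exprn_ile1// ?invr_ge0//
  invf_le1// ler1n.
have c01 : 0 < (2^-1 : R) < 1 by rewrite invr_gt0 ltr0n invf_lt1// ltr1n.
have up : 0 <= 2 * A + B.
  apply: (@ge0_of_decay _ 2^-1 _ (A / 2) 0) => // n.
  have := h01 n; have := h1 n; move: (2^-1 ^+ n) => e e1 e0.
  have := H (1 + e / 2); rewrite mulr0 addr0.
  have -> : (1 + e / 2) ^+ 2 * A + (1 + e / 2) * B + D =
    (e / 2) * (2 * A + B + e * (A / 2)) + (A + B + D) by field.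
  by rewrite ABD addr0 pmulr_rge0 ?divr_gt0//; apply;
    rewrite addr_gt0// divr_gt0.
(* Since [e <= 1], the point [1 - e / 2] stays positive. *)
have dn : 0 <= - (2 * A + B).
  apply: (@ge0_of_decay _ 2^-1 _ (A / 2) 0) => // n.
  have := h01 n; have := h1 n; move: (2^-1 ^+ n) => e e1 e0.
  have := H (1 - e / 2); rewrite mulr0 addr0.
  have -> : (1 - e / 2) ^+ 2 * A + (1 - e / 2) * B + D =
    (e / 2) * (- (2 * A + B) + e * (A / 2)) + (A + B + D) by field.
  by rewrite ABD addr0 pmulr_rge0 ?divr_gt0//; apply; lra.
rewrite /jmul_pure !ipE ip_pl -/A -/B; lra.
Qed.

(* [U_t X U_t^-1] is an order derivation for every [t > 0]; comparing the
   coefficients of this Laurent polynomial in [t] gives the bracket. *)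
Lemma order_derivation_bracket i (X : {linear V -> V}) : order_derivation X ->
  order_derivation (fun x => jmul_pure i (X x) - X (jmul_pure i x)).
Proof.
move=> DX x y Cx Cy xy0.
pose x2 := d i x *: p i; pose x1 := phalf i x; pose x0 := zfilter i x.
pose y2 := d i y *: p i; pose y1 := phalf i y; pose y0 := zfilter i y.
have H t : 0 < t -> ip (X (x2 + t *: x1 + t ^+ 2 *: x0))
                       (t ^+ 2 *: y2 + t *: y1 + y0) = 0.
  move=> t0; have tu : t != 0 by rewrite gt_eqF.
  have -> : t ^+ 2 *: y2 + t *: y1 + y0 = peirceU i t y.
    by rewrite /peirceU scalerA.
  have -> : x2 + t *: x1 + t ^+ 2 *: x0 = t ^+ 2 *: peirceU i t^-1 x.
    apply: (ip_inj HC) => z; rewrite /peirceU /x2 /x1 /x0 !ipE; field.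
    exact: tu.
  rewrite linearZ ipZl DX ?mulr0//.
  - by apply: peirceU_cone; rewrite ?invr_gt0.
  - exact: peirceU_cone.
  - by rewrite ip_peirceU peirceU_comp mulVf// peirceU1.
rewrite ipDl ipNl ip_jmul_pure.
have Ly : jmul_pure i y = y2 + 2^-1 *: y1 by [].
have Lx : jmul_pure i x = x2 + 2^-1 *: x1 by [].
have Xx : X x = X x2 + X x1 + X x0 by rewrite -!linearD -phalfE.
have Ey : y = y2 + y1 + y0 by exact: phalfE.
rewrite Ly Lx Xx [in X in _ - X]Ey; clearbody x0 x1 x2 y0 y1 y2.
(* [H] is a polynomial identity of degree 4 in [t]; five values kill all coefficients, and the
   bracket is a combination of them. *)
have := H 1 ltac:(by []); have := H 2 ltac:(by []); have := H 3 ltac:(by []).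
have := H 4 ltac:(by []); have := H 5 ltac:(by []).
rewrite !linearD !linearZ /= !ipE; lra.
Qed.

(** [br (p k)] is orthogonal to [p k] by skewness and to [u - p k] by the derivation property, hence
    to [u]. So [br u = 0], and [br u] is the difference of the two sides. *)
Lemma jmul_pure_sym i j : jmul_pure i (p j) = jmul_pure j (p i).
Proof.
pose br x := jmul_pure i (jmul_pure j x) - jmul_pure j (jmul_pure i x).
have brl : linear br.
  move=> a x y; rewrite /br !linearP.
  by apply: (ip_inj HC) => z; rewrite !ipE/=; ring.
have skew x y : ip (br x) y = - ip x (br y).
  by rewrite /br ipDl ipNl ipDr ipNr !ip_jmul_pure; ring.
have Dbr : order_derivation br.
  exact/order_derivation_bracket/jmul_pure_derivation.
have pk k : ip (p k) (br u) = 0.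
  have -> : ip (p k) (br u) = - ip (br (p k)) u by rewrite skew opprK.
  have -> : ip (br (p k)) u = ip (br (p k)) (p k) + ip (br (p k)) (u - p k).
    by rewrite -ipDr addrC subrK.
  rewrite (Dbr (p k) (u - p k)) ?addr0//; last 2 first.
  - exact: (sc_sub HC).
  - by rewrite ip_pl (d_sub HC).
  have := skew (p k) (p k); rewrite (ipC HC (p k)) => H; lra.
have bru : br u = 0.
  apply: (ip_inj HC) => x; rewrite ip0l (pure_decE HC x) ip_sumr big1// => k _.
  by rewrite ipZr ipC pk mulr0.
by move: bru; rewrite /br !jmul_pure_u => /subr0_eq.
Qed.

(** [peirceU j t] fixes [p i] and so preserves the face [d i = 0]. Being a combination of these
    maps, [jmul_pure j] preserves the range of [zfilter i]; by symmetry the two commute. *)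
Lemma jmul_pureC i j x : d i (p j) = 0 ->
  jmul_pure i (jmul_pure j x) = jmul_pure j (jmul_pure i x).
Proof.
move=> dij; have dji : d j (p i) = 0 by rewrite (sc_sym HC).
have Up t : peirceU j t (p i) = p i.
  by rewrite /peirceU dji phalf_orth// mulr0 scale0r scaler0 !add0r zfilter_id.
have UZ t y : 0 < t ->
    zfilter i (peirceU j t (zfilter i y)) = peirceU j t (zfilter i y).
  move=> t0.
  apply: (cone_linear_ext HC (F := zfilter i \o peirceU j t \o zfilter i)
    (G := peirceU j t \o zfilter i)) => z Cz /=.
  apply: zfilter_id; first by apply: peirceU_cone => //; exact: zfilterC.
  by rewrite -(ip_pl HC) -ip_peirceU Up ip_pl zfilter_face.
(* The coefficients interpolate the eigenvalues 1, 1/2, 0 from [t ^ 2], [t], 1 at [t = 2, 3, 1]. *)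
have LU y : jmul_pure j y =
    peirceU j 2 y - 4^-1 *: peirceU j 3 y - (3 / 4) *: peirceU j 1 y.
  by apply: (ip_inj HC) => z; rewrite /jmul_pure /peirceU !ipE; field.
have ZLZ y : zfilter i (jmul_pure j (zfilter i y)) = jmul_pure j (zfilter i y).
  by rewrite LU !linearB !linearZ /= !UZ.
have ZL y : zfilter i (jmul_pure j y) = jmul_pure j (zfilter i y).
  apply: (ip_inj HC) => z.
  rewrite ip_zfilter ip_jmul_pure -[in LHS]ZLZ -[LHS]ip_zfilter.
  by rewrite -[LHS]ip_jmul_pure -[LHS]ip_zfilter ZLZ.
rewrite !(jmul_pureE i) ZL.
have -> : jmul_pure j (2^-1 *: (x + d i x *: p i - zfilter i x)) =
    2^-1 *: (jmul_pure j x + d i x *: jmul_pure j (p i) - jmul_pure j (zfilter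
      i x)).
  by rewrite linearZ linearB linearD linearZ.
rewrite (jmul_pure_orth dji) -(ip_pl HC) -ip_jmul_pure (jmul_pure_orth dji).
by rewrite ip0l scale0r scaler0.
Qed.

(** * The product on all vectors and its Jordan identity *)

Definition jprod : V -> V -> V := bilinear_ext HC jmul_pure.

Lemma jprodC x y : jprod x y = jprod y x.
Proof. by apply: bilinear_extC => [i|];
  [exact: linearP | exact: jmul_pure_sym]. Qed.

Lemma jprod_linear a x y z :
  jprod (a *: x + y) z = a *: jprod x z + jprod y z.
Proof. by rewrite !(jprodC _ z) /jprod bilinear_ext_linearr// => i;
  exact: linearP. Qed.

Lemma ip_jprod x y z : ip (jprod x y) z = ip y (jprod x z).
Proof.
rewrite /jprod /bilinear_ext ip_suml ip_sumr; apply: eq_bigr => k _.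
by rewrite ipZl ipZr ip_jmul_pure.
Qed.

Lemma jprod_sum n (f : 'I_n -> I) (c : 'I_n -> R) y :
  jprod (\sum_a c a *: p (f a)) y = \sum_a c a *: jmul_pure (f a) y.
Proof.
rewrite jprodC /jprod linear_sumZ; last by apply: bilinear_ext_linearr => i;
  exact: linearP.
apply: eq_bigr => a _; rewrite bilinear_ext_pure//; last exact: jmul_pure_sym.
by move=> i; exact: linearP.
Qed.

Lemma jprod_frame n (f : 'I_n -> I) (c e : 'I_n -> R) : frame p d u f ->
  jprod (\sum_a c a *: p (f a)) (\sum_a e a *: p (f a)) =
  \sum_a (c a * e a) *: p (f a).
Proof.
move=> [orth _]; rewrite jprod_sum; apply: eq_bigr => a _.
rewrite (linear_sumZ _ _ _ (jmul_pure_linear _)) (bigD1 a)//= jmul_pure_id.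
rewrite scalerDr scalerA big1 ?scaler0 ?addr0// => b /negPf ba.
by rewrite jmul_pure_orth ?scaler0// orth eq_sym ba.
Qed.

Lemma jprod_jordan x y :
  jprod (jprod x x) (jprod y x) = jprod (jprod (jprod x x) y) x.
Proof.
have [n [f [c [fr ->]]]] := spectral HC x.
rewrite (jprod_frame _ _ fr) (jprodC y) !(jprodC (jprod _ _) (\sum_a _ *: _)).
rewrite !jprod_sum.
under eq_bigr do rewrite (linear_sumZ _ _ _ (jmul_pure_linear _)) scaler_sumr.
under [in RHS]eq_bigr do
  rewrite (linear_sumZ _ _ _ (jmul_pure_linear _)) scaler_sumr.
rewrite exchange_big; apply: eq_bigr => a _; apply: eq_bigr => b _.
rewrite !scalerA mulrC; congr (_ *: _).
have [->//|ab] := eqVneq a b.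
by rewrite jmul_pureC// (proj1 fr) eq_sym (negPf ab).
Qed.

(** A frame consists of orthogonal idempotents, so squares and square roots are taken
    coefficientwise. *)
Theorem sharp_cone_jordan : exists J : euclideanJordan V, C = cone_of_squares J.
Proof.
exists (EuclideanJordan jprodC jprod_linear jprod_jordan (ipC HC)
  (fun a x y z => etrans (ipDl HC _ _ _) (congr1 (+%R^~ _) (ipZl HC _ _ _)))
  (ip_gt0 HC) ip_jprod).
apply/seteqP; split=> [x Cx|_ [x _ <-]]/=.
  have [n [f [c [fr Ex c0]]]] := cone_spectral HC Cx.
  exists (\sum_a Num.sqrt (c a) *: p (f a)) => //=.
  rewrite (jprod_frame _ _ fr) Ex; apply: eq_bigr => a _.
  by rewrite -expr2 sqr_sqrtr.
have [n [f [c [fr ->]]]] := spectral HC x.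
rewrite (jprod_frame _ _ fr); apply: (cone_sum HC) => a.
by apply: CZ => //; rewrite -expr2 sqr_ge0.
Qed.

End Jordan.

(** * Scaling, and state diagrams as effects *)

Local Arguments castproc : simpl never.

Section Monoidal.
Variable O : opTheory.
Implicit Types A B C D E : O.

(** Coherence of the transports reduces to proof irrelevance. *)
Lemma castproc_irr A A' B B' (e1 e2 : A = A') (e1' e2' : B = B')
    (f : Proc A B) :
  castproc e1 e1' f = castproc e2 e2' f.
Proof. by rewrite (Prop_irrelevance e1 e2) (Prop_irrelevance e1' e2'). Qed.

Lemma castproc_id A B (e : A = A) (e' : B = B) (f : Proc A B) :
  castproc e e' f = f.
Proof. exact: (castproc_irr e (erefl A) e' (erefl B)). Qed.

Lemma castproc_trans A A' A'' B B' B'' (e1 : A = A') (e2 : A' = A'')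
    (e1' : B = B') (e2' : B' = B'') (f : Proc A B) :
  castproc e2 e2' (castproc e1 e1' f) =
  castproc (etrans e1 e2) (etrans e1' e2') f.
Proof. by case: A'' / e2; case: B'' / e2'; rewrite (castproc_irr _ e1 _ e1').
  Qed.

Lemma castproc_comp A A' B B' C C' (eA : A = A') (eB eB' : B = B') (eC : C = C')
    (g : Proc B C) (f : Proc A B) :
  castproc eB eC g \c castproc eA eB' f = castproc eA eC (g \c f).
Proof.
rewrite (Prop_irrelevance eB' eB).
by case: A' / eA; case: B' / eB {eB'}; case: C' / eC.
Qed.

Lemma comp_castproc_src A A' B C (eA : A = A') (g : Proc B C) (f : Proc A B) :
  g \c castproc eA (erefl B) f = castproc eA (erefl C) (g \c f).
Proof. by case: A' / eA. Qed.

Lemma castproc_par A A' B B' C D (eA : A = A') (eB : B = B')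
    (e : A \ox C = A' \ox C) (e' : B \ox D = B' \ox D)
    (f : Proc A B) (g : Proc C D) :
  castproc eA eB f \tx g = castproc e e' (f \tx g).
Proof. by case: A' / eA e; case: B' / eB e' => e' e; rewrite !castproc_id. Qed.

Lemma castproc_move A A' B B' (e1 : A = A') (e1' : B = B')
    (e2 : A' = A) (e2' : B' = B) (f : Proc A B) (g : Proc A' B') :
  castproc e1 e1' f = g -> f = castproc e2 e2' g.
Proof. by move=> <-; rewrite castproc_trans castproc_id. Qed.

Lemma par_unitr_cast A B (f : Proc A B) (eA : A = A \ox unitS)
    (eB : B = B \ox unitS) :
  f \tx idp unitS = castproc eA eB f.
Proof. exact: castproc_move (par_unitr f). Qed.

Lemma par_unitl_cast A B (f : Proc A B) (eA : A = unitS \ox A)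
    (eB : B = unitS \ox B) :
  idp unitS \tx f = castproc eA eB f.
Proof. exact: castproc_move (par_unitl f). Qed.

Lemma comp_scaleP A B C (a : Scal O) (g : Proc B C) (f : Proc A B) :
  g \c scaleP a f = scaleP a (g \c f).
Proof.
rewrite /scaleP -[in RHS](comp_idl a) par_comp.
by rewrite -(castproc_comp _ (tens1l B) (tens1l B)) par_unitl.
Qed.

Lemma scaleP_comp A B C (a : Scal O) (g : Proc B C) (f : Proc A B) :
  scaleP a g \c f = scaleP a (g \c f).
Proof.
rewrite /scaleP -[in RHS](comp_idr a) par_comp.
by rewrite -(castproc_comp _ (tens1l B) (tens1l B)) par_unitl.
Qed.

Lemma scaleP_scal (a b : Scal O) : scaleP a b = b \c a.
Proof.
rewrite -{1}(comp_idr b) -comp_scaleP; congr (_ \c _).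
by rewrite /scaleP (castproc_irr _ (tens1r unitS) _ (tens1r unitS)) par_unitr.
Qed.

Lemma scaleP_par A B E (a : Scal O) (f : Proc A B) :
  scaleP a f \tx idp E = scaleP a (f \tx idp E).
Proof.
rewrite /scaleP -par_assoc castproc_trans.
rewrite (castproc_par _ _ (congr1 (fun X => X \ox E) (tens1l A))
  (congr1 (fun X => X \ox E) (tens1l B))).
exact: castproc_irr.
Qed.

Lemma dapp_scaleP A B C D (u : diagram A B C D) (a : Scal O) (f : Proc A B) :
  dapp u (scaleP a f) = scaleP a (dapp u f).
Proof. by rewrite /dapp scaleP_par comp_scaleP scaleP_comp. Qed.

Definition effect_diagram A (e : Eff A) : sdiagram unitS A :=
  Diagram (anc := unitS) (castproc (erefl unitS) (esym (tens1r unitS)) (idp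
    unitS))
    (castproc (esym (tens1r A)) (erefl unitS) e).

Lemma dapp_effect A (e : Eff A) (rho : St A) :
  dapp (effect_diagram e) rho = e \c rho.
Proof.
rewrite /dapp /= (par_unitr_cast _ (esym (tens1r unitS)) (esym (tens1r A))).
by rewrite !castproc_comp comp_idr castproc_id.
Qed.

Definition diagram_effect A (u : sdiagram unitS A) : Eff A :=
  dg2 u \c (idp A \tx castproc (erefl unitS) (tens1l (anc u)) (dg1 u)) \c
  castproc (erefl A) (esym (tens1r A)) (idp A).

(** [dg1 u] prepares a state of the ancilla, which slides past [rho] by interchange. Hence effects
    alone separate vectors, as [VS_ext] states. *)
Lemma diagram_effectE A (u : sdiagram unitS A) (rho : St A) :
  dapp u rho = diagram_effect u \c rho.
Proof.
rewrite /dapp /diagram_effect.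
set s := castproc _ _ (dg1 u).
have -> : dg1 u = castproc (tens1l unitS) (erefl _) (idp unitS \tx s).
  rewrite (par_unitl_cast _ (esym (tens1l unitS)) (esym (tens1l (anc u)))).
  by rewrite castproc_trans /s castproc_trans castproc_id.
rewrite -!comp_assoc; congr (_ \c _).
have -> : castproc (erefl A) (esym (tens1r A)) (idp A) \c rho =
    castproc (tens1r unitS) (erefl _) (rho \tx idp unitS).
  rewrite (par_unitr_cast rho (esym (tens1r unitS)) (esym (tens1r A))).
  rewrite castproc_trans -[rho in LHS](castproc_id (erefl _) (erefl _)).
  by rewrite castproc_comp comp_idl; exact: castproc_irr.
rewrite !comp_castproc_src -!par_comp !comp_idl !comp_idr.
exact: castproc_irr.
Qed.

Definition diagram_comp A B (u : sdiagram unitS B) (F : Proc A B) :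
  sdiagram unitS A := Diagram (dg1 u) (dg2 u \c (F \tx idp (anc u))).

Lemma dapp_comp A B (u : sdiagram unitS B) (F : Proc A B) (rho : St A) :
  dapp (diagram_comp u F) rho = dapp u (F \c rho).
Proof.
rewrite /dapp /= -[idp (anc u) in RHS](comp_idl (idp (anc u))) par_comp.
by rewrite !comp_assoc.
Qed.

End Monoidal.

(** * The state cone *)

Section Opt.
Variables (R : realType) (T : OPT R).
Implicit Types A B E : T.

Let HT := optP T.
Local Notation sc := (scval T).

Lemma scval_ge0 (a : Scal T) : 0 <= sc a.
Proof.
have : range sc (sc a) by exists a.
by rewrite (opt_scalrange HT).
Qed.

Lemma scval_ex (x : R) : 0 <= x -> exists a : Scal T, sc a = x.
Proof.
move=> x0; have : [set x : R | 0 <= x] x by [].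
by rewrite -(opt_scalrange HT) => -[a _ <-]; exists a.
Qed.

Lemma scval_scaleP (a b : Scal T) : sc (scaleP a b) = sc a * sc b.
Proof. by rewrite scaleP_scal (opt_scalcomp HT) mulrC. Qed.

Lemma scval_dapp_scale A B (u : sdiagram A B) (a : Scal T) (f : Proc A B) :
  sc (dapp u (scaleP a f)) = sc a * sc (dapp u f).
Proof. by rewrite dapp_scaleP scval_scaleP. Qed.

Lemma prob_ge0 A (e : Eff A) (rho : St A) : 0 <= prob e rho.
Proof. exact: scval_ge0. Qed.

(** The feasible parts are mixed with weights proportional to their scalars, and the mixture is
    rescaled by the sum of the scalars. *)
Lemma proc_add A B (f g : Proc A B) : exists h : Proc A B,
  forall u : sdiagram A B, sc (dapp u h) = sc (dapp u f) + sc (dapp u g).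
Proof.
have [a [f0 [Ff ->]]] := opt_procscale HT f.
have [b [g0 [Fg ->]]] := opt_procscale HT g.
have [a0 b0] := (scval_ge0 a, scval_ge0 b).
have [s0|s0] := eqVneq (sc a + sc b) 0.
  exists (scaleP a f0) => u; rewrite !scval_dapp_scale.
  move/eqP: s0; rewrite paddr_eq0// => /andP[/eqP-> /eqP->].
  by rewrite !mul0r addr0.
have sp : 0 < sc a + sc b by rewrite lt_def s0 addr_ge0.
have [s Es] := scval_ex (ltW sp).
have [|h [_ Eh]] := opt_convex HT (p := sc a / (sc a + sc b)) Ff Fg.
  by rewrite divr_ge0 ?(ltW sp)//= ler_pdivrMr// mul1r lerDl.
exists (scaleP s h) => u; rewrite !scval_dapp_scale Eh Es.
by field.
Qed.

Lemma proc_sum A B (K : Type) (s : seq K) (z : Proc A B) (f : K -> Proc A B) :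
  exists h : Proc A B, forall u : sdiagram A B,
    sc (dapp u h) = \sum_(k <- s) sc (dapp u (f k)).
Proof.
elim: s => [|k s [h Eh]].
  have [a Ea] := scval_ex (lexx 0).
  by exists (scaleP a z) => u; rewrite scval_dapp_scale Ea mul0r big_nil.
have [h' Eh'] := proc_add (f k) h.
by exists h' => u; rewrite Eh' Eh big_cons.
Qed.

Lemma top_unit : top T (unitS : T) = idp unitS.
Proof.
apply/esym/(opt_topuniq HT)/(opt_testP HT) => E sigma.
by rewrite (big_pred1 tt) ?par_id ?comp_idl// => -[].
Qed.

Lemma top_tens_unit A (eA : A = A \ox unitS) :
  top T (A \ox unitS) = castproc eA (erefl unitS) (top T A).
Proof.
rewrite (opt_toptens HT) top_unit.
rewrite (par_unitr_cast _ eA (esym (tens1r unitS))) castproc_trans.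
exact: castproc_irr.
Qed.

Lemma test_sum A B (J : finType) (t : J -> Proc A B) (rho : St A) :
  test T t -> \sum_j prob (top T B) (t j \c rho) = prob (top T A) rho.
Proof.
move/(opt_testP HT) => /(_ unitS (castproc (erefl _) (esym (tens1r A)) rho)).
rewrite /prob (top_tens_unit (esym (tens1r B))) (top_tens_unit (esym (tens1r
  A))).
rewrite !castproc_comp !castproc_id => <-; apply: eq_bigr => j _.
rewrite (par_unitr_cast (t j) (esym (tens1r A)) (esym (tens1r B))).
by rewrite !castproc_comp castproc_id.
Qed.

Lemma measurement_sum A (J : finType) (e : J -> Eff A) (rho : St A) :
  measurement e -> \sum_j prob (e j) rho = prob (top T A) rho.
Proof.
move=> He; rewrite -(test_sum rho He); apply: eq_bigr => j _.
by rewrite /prob top_unit comp_idl.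
Qed.

Lemma normalized_ex A : exists rho : St A, normalized rho.
Proof.
have [rho Drho] := opt_detstate HT A; exists rho.
have := test_sum (idp unitS) Drho; rewrite (big_pred1 tt) => [|[]//].
by rewrite comp_idr /normalized => ->;
  rewrite /prob top_unit comp_idl opt_scalid.
Qed.

Lemma test_dappP A B (J : finType) (t : J -> Proc A B) : test T t <->
  forall E (sigma : St (A \ox E)),
    \sum_j sc (dapp (Diagram sigma (top T (B \ox E))) (t j)) =
    prob (top T (A \ox E)) sigma.
Proof.
split=> [/(opt_testP HT) H E sigma|H].
  by rewrite -H; apply: eq_bigr => j _; rewrite /prob comp_assoc.
apply/(opt_testP HT) => E sigma.
by rewrite -H; apply: eq_bigr => j _; rewrite /prob comp_assoc.
Qed.

(** Coarse-graining: [test_dappP] sees only sums of diagram values, so all other effects may be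
    merged. *)
Lemma binary_measurement A k (e : 'I_k -> Eff A) (j : 'I_k) : measurement e ->
  exists f : Eff A, measurement (fun b : 'I_2 => if b == ord0 then f else e j).
Proof.
move=> /test_dappP He.
have [f Ef] := proc_sum [seq i <- index_enum 'I_k | i != j] (e j) e.
exists f; apply/test_dappP => E sigma; rewrite -He.
by rewrite big_ord_recl big_ord1 /= Ef big_filter [RHS](bigD1 j)//= addrC.
Qed.

(** [e] is a multiple of a member of a measurement, whose effects sum to [top]. *)
Lemma effect_bounded A (e : Eff A) : exists2 K, 0 <= K &
  forall rho : St A, prob e rho <= K * prob (top T A) rho.
Proof.
have [a [g [[J [t [j [Ht <-]]]] ->]]] := opt_procscale HT e.
exists (sc a) => [|rho]; first exact: scval_ge0.
rewrite /prob scaleP_comp scval_scaleP ler_wpM2l ?scval_ge0//.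
rewrite -[leRHS](measurement_sum rho Ht) (bigD1 j)//= lerDl sumr_ge0// => *.
exact: prob_ge0.
Qed.

(** * Functionals on the space of states, and closedness of the cone *)

Definition evalat A (u : sdiagram unitS A) (v : VS A) : R := procfun v u.

Local Arguments evalat : simpl never.

Lemma evalat_linear A (u : sdiagram unitS A) : linear (evalat u : VS A -> R^o).
Proof. by move=> a x y. Qed.

HB.instance Definition _ A (u : sdiagram unitS A) :=
  GRing.isLinear.Build R (VS A) R *%R (evalat u) (evalat_linear u).

Lemma evalat_state A (u : sdiagram unitS A) (rho : St A) :
  evalat u (state_vec rho) = sc (dapp u rho).
Proof. by []. Qed.

Definition evl A (e : Eff A) : {scalar VS A} := evalat (effect_diagram e).

Lemma evl_state A (e : Eff A) (rho : St A) : evl e (state_vec rho) = prob e rho.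
Proof. by rewrite -[LHS]/(sc (dapp (effect_diagram e) rho)) dapp_effect. Qed.

Lemma VS_span A (v : VS A) : exists s : seq (R * St A),
  v = \sum_(k <- s) k.1 *: state_vec k.2.
Proof.
case: v => f Hf; have /asboolP[s Es] := Hf; exists s; apply: val_inj => /=.
by rewrite Es (big_morph (@procfun _ _ _ _) (fun _ _ => erefl) erefl).
Qed.

Lemma state_vec_scale A (a : Scal T) (rho : St A) :
  state_vec (scaleP a rho) = sc a *: state_vec rho.
Proof.
by apply: val_inj; apply/funext => u /=; rewrite /evalfun scval_dapp_scale.
Qed.

Lemma state_coneD A (x y : VS A) :
  state_cone x -> state_cone y -> state_cone (x + y).
Proof.
move=> [f _ <-] [g _ <-]; have [h Eh] := proc_add f g; exists h => //.
by apply: val_inj; apply/funext => u /=; rewrite /evalfun Eh.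
Qed.

Lemma state_coneZ A a (x : VS A) :
  0 <= a -> state_cone x -> state_cone (a *: x).
Proof.
move=> /scval_ex[c <-] [f _ <-]; exists (scaleP c f) => //.
exact: state_vec_scale.
Qed.

Lemma state_cone_vec A (rho : St A) : state_cone (state_vec rho).
Proof. by exists rho. Qed.

Lemma state_cone_pointed A (x : VS A) :
  state_cone x -> state_cone (- x) -> x = 0.
Proof.
move=> [f _ <-] [g _ E]; apply: val_inj; apply/funext => u /=.
have := congr1 (evalat u) E; rewrite linearN/= !evalat_state => fg.
apply/eqP; rewrite eq_le scval_ge0 andbT.
by rewrite -oppr_ge0 -fg scval_ge0.
Qed.

Lemma state_cone_generating A (v : VS A) :
  exists x y, [/\ state_cone x, state_cone y & v = x - y].
Proof.
have [s ->] := VS_span v; elim: s => [|[a f] s [x [y [Cx Cy E]]]].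
  have [rho _] := normalized_ex A.
  exists (state_vec rho), (state_vec rho); rewrite big_nil subrr.
  by split=> //; exact: state_cone_vec.
rewrite big_cons E /=; have [a0|a0] := leP 0 a.
  exists (a *: state_vec f + x), y; rewrite addrA; split=> //.
  by apply: state_coneD => //; apply: state_coneZ => //; exact: state_cone_vec.
exists x, (- a *: state_vec f + y); split=> //.
  apply: state_coneD => //; apply: state_coneZ; last exact: state_cone_vec.
  by rewrite oppr_ge0 ltW.
by rewrite opprD scaleNr opprK addrCA.
Qed.

Lemma evalat_evl A (u : sdiagram unitS A) (v : VS A) :
  evalat u v = evl (diagram_effect u) v.
Proof.
have [s ->] := VS_span v; rewrite !linear_sum; apply: eq_bigr => k _.
by rewrite !linearZ/= -/(evl _ _) evl_state evalat_state diagram_effectE.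
Qed.

Lemma VS_ext A (v : VS A) : (forall e, evl e v = 0) -> v = 0.
Proof.
move=> H; apply: val_inj; apply/funext => u.
by rewrite -[LHS]/(evalat u v) evalat_evl H.
Qed.

Lemma evl_ge0 A (e : Eff A) (x : VS A) : state_cone x -> 0 <= evl e x.
Proof. by move=> [f _ <-]; rewrite evl_state prob_ge0. Qed.

Lemma evl_bounded A (e : Eff A) : exists2 K, 0 <= K &
  forall x : VS A, state_cone x -> evl e x <= K * evl (top T A) x.
Proof.
have [K K0 H] := effect_bounded e; exists K => // _ [f _ <-].
by rewrite !evl_state.
Qed.

Lemma ge0_limit (x y : R) : (forall e, 0 < e -> 0 <= x + e * y) -> 0 <= x.
Proof.
move=> H; have [//|x0] := leP 0 x.
have M0 : 0 < `|y| + 1 by rewrite ltr_wpDl.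
have e0 : 0 < - x / (2 * (`|y| + 1)) by rewrite divr_gt0 ?oppr_gt0 ?mulr_gt0.
have := H _ e0; set e := _ / _ in e0 *.
have : e * y <= - x / 2.
  rewrite (le_trans (ler_wpM2l (ltW e0) (ler_norm y)))//.
  have -> : - x / 2 = e * (`|y| + 1) by rewrite /e; field; rewrite gt_eqF.
  by rewrite ler_wpM2l ?(ltW e0)// lerDl.
by move=> *; lra.
Qed.

Lemma state_cone_segment A (z w : VS A) :
  evl (top T A) z = 1 -> evl (top T A) w = 1 ->
  (forall e, 0 < e < 1 -> state_cone (z + e *: (w - z))) -> state_cone z.
Proof.
move=> tz tw H; have [n [h [hl hb]]] := opt_findim HT unitS A.
have hinj : injective h := bij_inj hb.
pose S : set 'rV[R]_n :=
  [set h (vec rho) | rho in [set rho : St A | normalized rho]].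
have Scl : closed S := opt_closed HT hl hb.
suff : S (h z) by move=> [rho _ /hinj <-]; exact: state_cone_vec.
apply: Scl => B /nbhs_ballP[e /= e0 Be].
pose v := h (w - z); pose M := 1 + \sum_j `|v ord0 j|.
have M0 : 0 < M by rewrite ltr_wpDr// sumr_ge0.
(* [M] exceeds every coordinate of [v], so [r * M < e] puts the point of the segment at parameter
   [r] in the ball. *)
pose r := Num.min 2^-1 (e / (2 * M)).
have r0 : 0 < r by rewrite lt_min invr_gt0 ltr0n divr_gt0// mulr_gt0.
have r1 : r < 1 by rewrite gt_min invf_lt1// ltr1n.
have rM : r * M < e.
  rewrite (le_lt_trans (y := e / 2))//;
    last by rewrite ltr_pdivrMr// ltr_pMr// ltr1n.
  have -> : e / 2 = e / (2 * M) * M by field; rewrite gt_eqF.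
  by rewrite ler_wpM2r ?(ltW M0)// ge_min lexx orbT.
have [|rho _ Erho] := H r; first by rewrite r0.
exists (h (state_vec rho)); split.
  exists rho => //; rewrite /= /normalized -evl_state Erho.
  by rewrite linearD linearZ linearB/= tz tw subrr mulr0 addr0.
apply: Be; split=> // i j; rewrite Erho addrC hl mxE ord1 addrC.
rewrite mxE /ball /= opprD addrA subrr sub0r normrN normrM gtr0_norm//.
rewrite (le_lt_trans _ rM)// ler_wpM2l ?(ltW r0)//.
rewrite /M (bigD1 j)//= addrCA lerDl.
by rewrite addr_ge0// sumr_ge0.
Qed.

(** Puts a point between two normalized vectors in the form that the hypothesis of [state_cone_arch]
    covers. *)
Lemma convex_rescale (V : lmodType R) (x y : V) (a b e : R) :
  a != 0 -> b != 0 -> 1 - e != 0 ->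
  a^-1 *: x + e *: (b^-1 *: y - a^-1 *: x) =
  ((1 - e) / a) *: (x + (e * a / ((1 - e) * b)) *: y).
Proof.
move=> a0 b0 e0; rewrite scalerBr scalerDr !scalerA addrCA addrC -scalerBl.
by congr (_ *: _ + _ *: _); field; rewrite ?a0 ?b0 ?e0.
Qed.

(* [opt_closed] only closes the set of normalized states, so a positive trace is
   needed to normalize; a limit of trace zero vanishes because effects are
   bounded by the trace. *)
Lemma state_cone_arch A (w z : VS A) : state_cone w ->
  (forall e, 0 < e -> state_cone (z + e *: w)) -> state_cone z.
Proof.
move=> Cw H; pose t : {scalar VS A} := evl (top T A).
have C0 : state_cone (0 : VS A) by rewrite -(scale0r w); exact: state_coneZ.
have ge e : 0 <= evl e z.
  apply: (@ge0_limit _ (evl e w)) => r r0.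
  by have := evl_ge0 e (H _ r0); rewrite linearD linearZ.
have z0 : t z = 0 -> state_cone z.
  move=> tz; suff -> : z = 0 by [].
  apply: VS_ext => e; apply/eqP; rewrite eq_le ge andbT -oppr_ge0.
  have [K K0 HK] := evl_bounded e.
  apply: (@ge0_limit _ (K * t w - evl e w)) => r r0.
  have := HK _ (H _ r0); rewrite !linearD !linearZ/= -!/(t _) tz.
  by move=> *; lra.
have [/z0//|tz] := eqVneq (t z) 0.
have tz0 : 0 < t z by rewrite lt_def tz ge.
have [tw|tw] := eqVneq (t w) 0.
  suff w0 : w = 0 by have := H 1 ltac:(by []); rewrite w0 scaler0 addr0.
  apply: VS_ext => e; apply/eqP; rewrite eq_le evl_ge0// andbT.
  have [K K0 HK] := evl_bounded e.
  by rewrite (le_trans (HK _ Cw))// -/(t w) tw mulr0.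
have tw0 : 0 < t w by rewrite lt_def tw evl_ge0.
suff : state_cone ((t z)^-1 *: z).
  move/(state_coneZ (ltW tz0)); rewrite scalerA mulfV// scale1r //.
apply: (@state_cone_segment _ _ ((t w)^-1 *: w)).
- by rewrite linearZ/= -/(t z) mulVf.
- by rewrite linearZ/= -/(t w) mulVf.
move=> e /andP[e0 e1]; have e1' : 0 < 1 - e by rewrite subr_gt0.
rewrite convex_rescale ?gt_eqF//.
by apply: state_coneZ; [rewrite divr_ge0// ltW | apply: H;
  rewrite divr_gt0// mulr_gt0].
Qed.

Lemma state_cone_archimedean A : archimedean_cone (@state_cone R T A).
Proof.
split; [exact: state_coneD | exact: state_coneZ | exact: state_cone_pointed |
        exact: state_cone_generating | exact: state_cone_arch].
Qed.

Lemma spanpred_comp A B (F : Proc A B) (f : sdiagram unitS A -> R^o) :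
  f \in @spanpred R T unitS A ->
  (fun u => f (diagram_comp u F)) \in @spanpred R T unitS B.
Proof.
move=> /asboolP[s ->]; apply/asboolP.
exists [seq (k.1, F \c k.2) | k <- s]; apply/funext => u.
rewrite big_map !fct_sumE; apply: eq_bigr => k _.
by rewrite -[LHS]/(k.1 * sc (dapp (diagram_comp u F) k.2)) dapp_comp.
Qed.

(** Diagrams are pulled back along [F]; linearity is then immediate and no decomposition of [v] has
    to be chosen. *)
Definition push A B (F : Proc A B) (v : VS A) : VS B :=
  ProcSpace (spanpred_comp F (valP v)).

Lemma push_linear A B (F : Proc A B) : linear (push F).
Proof. by move=> a x y; apply: val_inj. Qed.

HB.instance Definition _ A B (F : Proc A B) :=
  GRing.isLinear.Build R (VS A) (VS B) *:%R (push F) (push_linear F).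

Lemma push_state A B (F : Proc A B) (rho : St A) :
  push F (state_vec rho) = state_vec (F \c rho).
Proof.
apply: val_inj; apply/funext => u.
by rewrite -[LHS]/(sc (dapp (diagram_comp u F) rho)) dapp_comp.
Qed.

End Opt.

(** * Daggers *)

Section Daggers.
Variables (R : realType) (T : OPT R).
Hypothesis Hsharp : symmetric_sharpness T.
Hypothesis Hmix : complete_mixing T.
Hypothesis Hfilt : filtering T.
Variable A : T.

Local Notation C := (@state_cone R T A).

Definition pure_state := {phi : St A | npure phi}.
Implicit Types i j : pure_state.

Definition pure_vec i : VS A := state_vec (sval i).

Lemma dagger_ex i : exists e : Eff A, is_dagger (sval i) e.
Proof.
by have [H _ _] := Hsharp A; have [e [He _]] := H _ (svalP i); exists e.
Qed.

Definition dagger i : Eff A := sval (cid (dagger_ex i)).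

Lemma daggerP i : is_dagger (sval i) (dagger i).
Proof. exact: svalP (cid (dagger_ex i)). Qed.

Lemma dagger_uniq i (e : Eff A) : is_dagger (sval i) e -> dagger i = e.
Proof.
have [H _ _] := Hsharp A; have [e' [_ He']] := H _ (svalP i) => De.
by rewrite -(He' _ De) -(He' _ (daggerP i)).
Qed.

Lemma maximal_dagger (e : Eff A) : maximal_effect e -> exists i, dagger i = e.
Proof.
move=> Me; have [_ H _] := Hsharp A; have [phi [[Np Ep] _]] := H _ Me.
by exists (exist _ phi Np); apply: dagger_uniq.
Qed.

Definition dagger_fun i : {scalar VS A} := evl (dagger i).

Local Arguments dagger_fun : simpl never.

Lemma dagger_vec i j : dagger_fun i (pure_vec j) = prob (dagger i) (sval j).
Proof. exact: evl_state. Qed.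

Lemma dagger_diag i : dagger_fun i (pure_vec i) = 1.
Proof. by rewrite dagger_vec; case: (daggerP i). Qed.

Lemma dagger_sym i j : dagger_fun i (pure_vec j) = dagger_fun j (pure_vec i).
Proof.
have [_ _ H] := Hsharp A; rewrite !dagger_vec.
by apply: (H _ _ _ _ (svalP j) (svalP i)); exact: daggerP.
Qed.

Lemma dagger_sharp i j : dagger_fun i (pure_vec j) = 1 -> sval i = sval j.
Proof.
rewrite dagger_vec => E; have [Mi Ei] := daggerP i.
have [_ H _] := Hsharp A; have [phi [_ U]] := H _ Mi.
have <- := U (sval i) (conj (svalP i) Ei).
by have <- := U (sval j) (conj (svalP j) E).
Qed.

(** A maximal measurement containing [dagger i] is coarse-grained to two effects; [rho] gives all
    its weight to the other one. *)
Lemma orthogonal_distinguishable (rho : St A) i : dagger_fun i (state_vec rho)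
  = 0 ->
  perfectly_distinguishable (tnth [tuple rho; sval i]).
Proof.
rewrite evl_state => d0; have [[k [m [[Hm _] [a _ Ea]]]] Ei] := daggerP i.
have [f Hf] := binary_measurement a Hm; rewrite Ea in Hf.
exists 2, (fun b : 'I_2 => if b == ord0 then f else dagger i); split=> //.
exists (leqnn 2) => b; case: (unliftP ord0 b) => [c|] ->.
  rewrite (ord1 c) (tnth_nth rho)/= Ei.
  by case: (svalP i).
rewrite (tnth_nth rho)/=.
have := measurement_sum rho Hf.
by rewrite big_ord_recl big_ord1 /= d0 addr0.
Qed.

(** Maximal effects are daggers. Without pure states complete mixing would hold vacuously for the
    zero state, whose face would then contain a normalized state. *)
Lemma pure_state_ex : inhabited pure_state.
Proof.
apply: contrapT => N; have [rho Nrho] := normalized_ex A.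
have [a Ea] := scval_ex T (lexx (0 : R)).
have [|_ F] := Hmix (rho := scaleP a rho).
  by move=> e /maximal_dagger[i _]; case: N.
have : face C (state_vec (scaleP a rho)) (state_vec rho).
  by rewrite F; exact: state_cone_vec.
rewrite state_vec_scale Ea scale0r => -[_ [e e0]].
rewrite /cone_le sub0r => CN.
have /eqP : e *: state_vec rho = 0.
  by apply: state_cone_pointed => //; apply: state_coneZ;
    [exact: ltW | exact: state_cone_vec].
rewrite scaler_eq0 gt_eqF//= => /eqP/(congr1 (evl (top T A))).
by rewrite evl_state Nrho linear0 => /eqP; rewrite oner_eq0.
Qed.

Lemma pure_cone i : C (pure_vec i).
Proof. exact: state_cone_vec. Qed.

Let HA := state_cone_archimedean A.

Lemma dagger_mix (y : VS A) : C y -> (forall i, dagger_fun i y != 0) ->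
  forall z, C z -> exists2 e, 0 < e & C (y - e *: z).
Proof.
move=> [rho _ <-] dy z Cz; have [|_ F] := Hmix (rho := rho).
  move=> e /maximal_dagger[i <-]; apply/eqP.
  by have := dy i; rewrite /dagger_fun evl_state.
have : face C (state_vec rho) z by rewrite F.
by case=> _ [e e0 H]; exists e.
Qed.

(* Every normalized pure state belongs to the set of states that a maximal
   measurement distinguishes; the sum of this set pairs to 1 with all daggers.
     *)
Lemma pure_unit_ex i : exists w, [/\ C w, C (w - pure_vec i) &
  forall j, dagger_fun j w = 1].
Proof.
have [[k [m [[Hm [phi [Iphi Mphi Dphi]]] [a _ Ea]]]] Ei] := daggerP i.
have Np b : npure (phi b) by case: Mphi => -[_ Nphi] _; apply: Nphi; exists b.
pose q b : pure_state := exist _ (phi b) (Np b).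
have Dq b : dagger (q b) = m b.
  apply: dagger_uniq; split.
    exists k, m; split; last by exists b.
    by split=> //; exists phi.
  have [km Hd] := Dphi; have := Hd b.
  have -> : widen_ord km b = b by apply: val_inj.
  by case: (Np b) => -> _.
have qa : pure_vec (q a) = pure_vec i.
  by rewrite /pure_vec (@dagger_sharp (q a) i)// dagger_vec Dq Ea.
exists (\sum_b pure_vec (q b)); split.
- by apply: (cone_sum HA) => b; exact: pure_cone.
- rewrite (bigD1 a)//= qa addrAC subrr add0r.
  elim/big_ind: _ => [|x y|b _]; [exact: (cone0 HA) | exact: state_coneD |].
  exact: pure_cone.
- move=> j; rewrite linear_sum.
  under eq_bigr do rewrite dagger_sym dagger_vec Dq.
  by rewrite measurement_sum//; case: (svalP j).
Qed.

(** By complete mixing, some dagger kills [v - mu *: v'] for the largest [mu]; its value there is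
    [1 - mu], so [mu = 1] and [v - v'] is in the cone. Exchanging the roles concludes. *)
Lemma pure_unit_uniq i (w w' : VS A) : C w -> C w' ->
  (forall j, dagger_fun j w = 1) -> (forall j, dagger_fun j w' = 1) -> w = w'.
Proof.
have key v v' : C v -> C v' -> (forall j, dagger_fun j v = 1) ->
    (forall j, dagger_fun j v' = 1) -> C (v - v').
  move=> Cv Cv' dv dv'.
  have v0 : v' != 0.
    by apply/eqP => v0; have := dv' i; rewrite v0 linear0 => /esym/eqP;
      rewrite oner_eq0.
  have [mu [_ Cmu Nmu]] := cone_tight HA Cv Cv' v0.
  suff [j] : exists j, dagger_fun j (v - mu *: v') = 0.
    have -> : dagger_fun j (v - mu *: v') = dagger_fun j v - mu * dagger_fun j
      v'.
      by rewrite linearB; congr (_ - _); exact: linearZ.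
    by rewrite dv dv' mulr1 => /subr0_eq mu1; rewrite -mu1 scale1r in Cmu.
  apply: contrapT => N; have [|e e0] := dagger_mix Cmu _ Cv'.
    by move=> j; apply/eqP => dj; apply: N; exists j.
  exact: Nmu.
move=> Cw Cw' dw dw'; apply/subr0_eq/state_cone_pointed; first exact: key.
by rewrite opprB; exact: key.
Qed.

Lemma filter_ex i c : 0 <= c <= 1 -> exists F : Proc A A,
  [/\ push F (pure_vec i) = c *: pure_vec i,
    forall x, C x -> dagger_fun i x = 0 -> push F x = x &
    0 < c -> exists G : Proc A A,
      cancel (push F) (push G) /\ cancel (push G) (push F)].
Proof.
move=> /andP[c0 c1]; have [a Ea] := scval_ex T c0; rewrite -Ea in c1 *.
have [F [_ Fphi Fid Finv]] := Hfilt (svalP i) c1; exists F; split.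
- by rewrite push_state Fphi state_vec_scale.
- move=> _ [rho _ <-] d0; rewrite push_state Fid//.
  exact: orthogonal_distinguishable.
- move=> /Finv[G FG]; exists G.
  split=> v.
    apply: (cone_linear_ext HA (F := push G \o push F) (G := idfun)).
    by move=> _ [f _ <-] /=; rewrite !push_state (proj1 (FG f)).
  apply: (cone_linear_ext HA (F := push F \o push G) (G := idfun)).
  by move=> _ [f _ <-] /=; rewrite !push_state (proj2 (FG f)).
Qed.

Lemma push_cone (F : Proc A A) x : C x -> C (push F x).
Proof. by move=> [rho _ <-]; rewrite push_state; exact: state_cone_vec. Qed.

Lemma state_cone_sharp : exists u, sharp_cone C pure_vec dagger_fun u.
Proof.
have [i0] := pure_state_ex.
have [u [Cu _ du]] := pure_unit_ex i0; exists u; split=> //.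
- exact: pure_cone.
- by move=> i x; exact: evl_ge0.
- exact: dagger_sym.
- exact: dagger_diag.
- by move=> i j /dagger_sharp; rewrite /pure_vec => ->.
(* [u] comes from [i0], but the unit obtained from [i] is the same vector. *)
- move=> i; have [w [Cw Cwi dw]] := pure_unit_ex i.
  by rewrite (pure_unit_uniq i Cu Cw du dw).
- exact: dagger_mix.
- move=> i y Cy Cyi; have [_ [_ F]] := svalP i.
  have : face C (state_vec (sval i)) y.
    by split=> //; exists 1; rewrite // /cone_le scale1r.
  by rewrite F => -[a _ <-]; exists a.
- move=> i; have [|F [Fi Fid _]] := @filter_ex i 0; first by rewrite lexx ler01.
  by exists (push F); split=> //;
    [exact: push_cone | exact: etrans Fi (scale0r _)].
- move=> i c /andP[c0 c1]; have [|F [Fi Fid]] := @filter_ex i c.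
    by rewrite !ltW.
  move=> /(_ c0)[G FG]; exists (push F), (push G); split=> //.
  by move=> x Cx; split; exact: push_cone.
Qed.

End Daggers.

(* [J] lives on the vector space [VS A] spanned by the states of [A], so the two
   coincide as real vector spaces. *)
Theorem theorem27 (R : realType) (T : OPT R)
    (Hsharp : symmetric_sharpness T)
    (Hmix : complete_mixing T)
    (Hfilt : filtering T)
    (A : T) :
  exists J : euclideanJordan (VS A), @state_cone R T A = cone_of_squares J.
Proof.
have [u Hu] := state_cone_sharp Hsharp Hmix Hfilt A.
exact: sharp_cone_jordan Hu.
Qed.
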